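(* There exists $q\in L^2(\mathbb{R})$ such that, for every $k\in\mathbb{R}$, neither of the limits $\lim_{T\to\infty}\mathfrak{a}(k,q^{\langle T\rangle})$ and $\lim_{T\to\infty}\mathfrak{b}(k,q^{\langle T\rangle})$ exists.
   Context: For $q\in L^1_{\mathrm{loc}}(\mathbb{R})$ and $T>0$ let $q^{\langle T\rangle}=q\chi_{|x|<T}$. For $k\in\mathbb{R}$ let $\widetilde X(x,k)$ be the $2\times2$ matrix solution of $\partial_x\widetilde X=\begin{pmatrix}0&\overline{q^{\langle T\rangle}(x)}e^{-ikx}\\ q^{\langle T\rangle}(x)e^{ikx}&0\end{pmatrix}\widetilde X$ with $\widetilde X(x,k)=I$ for $x\leqslant -T$. For $x\geqslant T$ it is constant and equals $\begin{pmatrix}\mathfrak{a}(k,q^{\langle T\rangle})&\mathfrak{b}^\#(k,q^{\langle T\rangle})\\ \mathfrak{b}(k,q^{\langle T\rangle})&\mathfrak{a}^\#(k,q^{\langle T\rangle})\end{pmatrix}$, where $f^\#(k)=\overline{f(\bar k)}$; this defines the $SU(1,1)$ nonlinear Fourier transform $(\mathfrak{a},\mathfrak{b})$ on $\mathbb{R}$. *)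

(* Defs.v *)
From mathcomp Require Import all_boot all_order all_algebra.
From mathcomp Require Import all_classical all_reals all_analysis.
From mathcomp.real_closed Require Import complex.

Set Implicit Arguments.
Unset Strict Implicit.
Unset Printing Implicit Defensive.

Import Order.TTheory GRing.Theory Num.Theory.
Local Open Scope classical_set_scope.
Local Open Scope ring_scope.

Section NLFT.
Variable R : realType.

Local Notation mu := (@lebesgue_measure R).

Definition cexpi (t : R) : R[i] := Complex (cos t) (sin t).

Definition cconj (z : R[i]) : R[i] := Complex (complex.Re z) (- complex.Im z).

Definition cabs (z : R[i]) : R := Num.sqrt (complex.Re z ^+ 2 + complex.Im z ^+ 2).

Definition trunc (q : R -> R[i]) (T : R) : R -> R[i] :=
  fun x => if `|x| < T then q x else 0.

Definition cmeasurable (f : R -> R[i]) : Prop :=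
  measurable_fun setT (fun x => complex.Re (f x)) /\ measurable_fun setT (fun x => complex.Im (f x)).

Definition L2 (q : R -> R[i]) : Prop :=
  cmeasurable q /\
  (\int[mu]_x ((cabs (q x)) ^+ 2)%:E < +oo)%E.

Definition cintegrable (D : set R) (f : R -> R[i]) : Prop :=
  mu.-integrable D (fun x => (complex.Re (f x))%:E) /\
  mu.-integrable D (fun x => (complex.Im (f x))%:E).

Definition cint (D : set R) (f : R -> R[i]) : R[i] :=
  Complex (Rintegral mu D (fun x => complex.Re (f x))) (Rintegral mu D (fun x => complex.Im (f x))).

Definition i0 : 'I_2 := ord0.
Definition i1 : 'I_2 := ord_max.

Definition coef_mx (p : R -> R[i]) (k x : R) : 'M[R[i]]_2 :=
  \matrix_(i < 2, j < 2)
    if (i == i0) && (j == i1) then cconj (p x) * cexpi (- (k * x))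
    else if (i == i1) && (j == i0) then p x * cexpi (k * x)
    else 0.

(* X is the (Caratheodory) solution of d/dx X = coef_mx p k x * X with
   X x = I for x <= -T, written in its equivalent integral form. *)
Definition nlft_sol (p : R -> R[i]) (T k : R) (X : R -> 'M[R[i]]_2) : Prop :=
  (forall x, x <= - T -> X x = 1%:M) /\
  (forall x, - T <= x -> forall i j : 'I_2,
      cintegrable `[- T, x] (fun s => (coef_mx p k s *m X s) i j) /\
      X x i j = (1%:M : 'M[R[i]]_2) i j
                + cint `[- T, x] (fun s => (coef_mx p k s *m X s) i j)).

Definition ccvg_infty (f : R -> R[i]) (l : R[i]) : Prop :=
  forall e : R, 0 < e -> exists M : R, forall T, M < T -> cabs (f T - l) < e.

End NLFT.

(* Main.v *)
(* For real [k] the truncated transforms are the entries of an ordered product of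
   transfer matrices in SU(1,1).  A potential of small L^2 norm can only move the
   moduli of [a] and [b] a little, but it can turn their phases: a chirp
   [c e^(-i Phi)] whose local frequency [Phi'] increases slowly from [-W] to [W]
   acts on a given [k], before the frequency reaches [k], almost as the rotation
   [diag (e^(-i th), e^(i th))], where [th] is the integral of [c^2 / (k - Phi')].
   This integral diverges logarithmically at the resonance, so with a slow enough
   sweep [th] reaches [1] for every [|k| <= W - 2] however small the L^2 norm is.
   The potential is a sequence of such sweeps with growing windows and summable L^2
   norms, preceded by [1 / (1 + x)] on [0, 1), which makes [|b|] at least of order
   [1 / (1 + |k|)]; the sweeps are too weak to destroy this lower bound.  Hence [a]
   and [b] keep a positive modulus while being turned by an angle between [1] and
   [3/2] infinitely often, for every [k].

   Sweeps are realised by frequencies that are constant on unit intervals.  There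
   the system has an explicit propagator, and conjugating by its exact eigenvectors
   reduces every error to the total variation of a monotone function of the
   detuning [k - Phi']. *)
Require Import Defs.
From mathcomp Require Import all_boot all_order all_algebra.
From mathcomp Require Import all_classical all_reals all_analysis.
From mathcomp.real_closed Require Import complex.
From mathcomp Require Import measurable_realfun ring lra zify.

Set Implicit Arguments.
Unset Strict Implicit.
Unset Printing Implicit Defensive.

Import Order.TTheory GRing.Theory Num.Theory.
Import numFieldNormedType.Exports.
Local Open Scope classical_set_scope.
Local Open Scope ring_scope.

(** * Componentwise calculus of complex functions *)


Section ComplexCalculus.
Variable R : realType.
Implicit Types (f g : R -> R[i]) (x : R).

(** Scaling of a sweep. With amplitude [d / r], frequency increment [1 / r^2] per unit interval and
    window half-width [W], a sweep has [2 W r^2] pieces, so its squared L^2 norm is [2 W d^2]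
    whatever the resolution [r]. The turning per piece is about [c^2 / s] at detuning [s], where
    [c = d / r]; summed from [s] of order 1 down to [1 / r] it is about [d^2 ln r], which [r] makes
    as large as desired. The zone [|s| < 1 / r] holds about [2 r] pieces, each changing the moduli
    by a factor [1 + O(d / r)], so crossing the resonance costs only [O(d)]. Thus [d] is fixed first
    by the error budget and [r] afterwards by the phase. The errors must moreover decay like
    [1 / (1 + |k|)], since the excess of [|a| + |b|] over 1 that protects [|b|] is only of that
    order. *)

Lemma ReD (x y : R[i]) : complex.Re (x + y) = complex.Re x + complex.Re y.
Proof. by case: x y => [a b] [c d]. Qed.

Lemma ImD (x y : R[i]) : complex.Im (x + y) = complex.Im x + complex.Im y.
Proof. by case: x y => [a b] [c d]. Qed.

Lemma ReN (x : R[i]) : complex.Re (- x) = - complex.Re x.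
Proof. by case: x. Qed.

Lemma ImN (x : R[i]) : complex.Im (- x) = - complex.Im x.
Proof. by case: x. Qed.

Lemma ReM (x y : R[i]) : complex.Re (x * y) =
  complex.Re x * complex.Re y - complex.Im x * complex.Im y.
Proof. by case: x y => [a b] [c d]. Qed.

Lemma ImM (x y : R[i]) : complex.Im (x * y) =
  complex.Re x * complex.Im y + complex.Im x * complex.Re y.
Proof. by case: x y => [a b] [c d]. Qed.

Lemma complex_eq (x y : R[i]) : complex.Re x = complex.Re y ->
  complex.Im x = complex.Im y -> x = y.
Proof. by case: x y => [a b] [c d] /= -> ->. Qed.

Definition ReIm := (ReD, ImD, ReN, ImN, ReM, ImM).

Definition cder f x (d : R[i]) : Prop :=
  is_derive x 1 (fun t => complex.Re (f t)) (complex.Re d) /\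
  is_derive x 1 (fun t => complex.Im (f t)) (complex.Im d).

Lemma is_derive_eqd (h : R -> R) x a b : is_derive x 1 h a -> a = b -> is_derive x 1 h b.
Proof. by move=> + <-. Qed.

Lemma cder_eq f x d e : cder f x d -> d = e -> cder f x e.
Proof. by move=> + <-. Qed.

Lemma cder_cst (c : R[i]) x : cder (fun=> c) x 0.
Proof. by split; exact: is_derive_cst. Qed.

Lemma cderD f g x d e : cder f x d -> cder g x e ->
  cder (fun t => f t + g t) x (d + e).
Proof.
move=> [f1 f2] [g1 g2]; split; rewrite ReIm.
  by under eq_fun do rewrite ReIm; apply: is_deriveD.
by under eq_fun do rewrite ReIm; apply: is_deriveD.
Qed.

Lemma cderN f x d : cder f x d -> cder (fun t => - f t) x (- d).
Proof.
move=> [f1 f2]; split; rewrite ReIm.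
  by under eq_fun do rewrite ReIm; apply: is_deriveN.
by under eq_fun do rewrite ReIm; apply: is_deriveN.
Qed.

Lemma cderB f g x d e : cder f x d -> cder g x e ->
  cder (fun t => f t - g t) x (d - e).
Proof. by move=> fd ge; apply: cderD => //; exact: cderN. Qed.

Lemma is_derive_mulr (h l : R -> R) x a b : is_derive x 1 h a -> is_derive x 1 l b ->
  is_derive x 1 (fun t => h t * l t) (a * l x + h x * b).
Proof.
move=> ha lb; apply: is_derive_eqd (is_deriveM ha lb) _.
by rewrite /GRing.scale /=; ring.
Qed.

Lemma is_derive_addr (h l : R -> R) x a b : is_derive x 1 h a -> is_derive x 1 l b ->
  is_derive x 1 (fun t => h t + l t) (a + b).
Proof. by move=> ha lb; exact: is_deriveD. Qed.

Lemma is_derive_subr (h l : R -> R) x a b : is_derive x 1 h a -> is_derive x 1 l b ->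
  is_derive x 1 (fun t => h t - l t) (a - b).
Proof. by move=> ha lb; exact: is_deriveB. Qed.

Lemma cderM f g x d e : cder f x d -> cder g x e ->
  cder (fun t => f t * g t) x (d * g x + f x * e).
Proof.
move=> [f1 f2] [g1 g2]; split.
  under eq_fun do rewrite ReIm.
  refine (is_derive_eqd (is_derive_subr (is_derive_mulr f1 g1) (is_derive_mulr f2 g2)) _).
  by rewrite !ReIm; ring.
under eq_fun do rewrite ReIm.
refine (is_derive_eqd (is_derive_addr (is_derive_mulr f1 g2) (is_derive_mulr f2 g1)) _).
by rewrite !ReIm; ring.
Qed.

Lemma cderJ f x d : cder f x d -> cder (fun t => cconj (f t)) x (cconj d).
Proof. by move=> [f1 f2]; split => //=; apply: is_deriveN. Qed.

Lemma cder_real (h : R -> R) x a : is_derive x 1 h a ->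
  cder (fun t => (h t)%:C%C) x a%:C%C.
Proof. by move=> ha; split => //=; exact: is_derive_cst. Qed.

Lemma is_derive_affine (a b x : R) : is_derive x 1 (fun t => a + b * t) b.
Proof.
refine (is_derive_eqd (is_derive_addr (is_derive_cst a x 1)
  (is_derive_mulr (is_derive_cst b x 1) (is_derive_id x 1))) _).
by rewrite /=; ring.
Qed.

Lemma is_derive_cos_affine (a b x : R) :
  is_derive x 1 (fun t => cos (a + b * t)) (- b * sin (a + b * x)).
Proof.
refine (is_derive_eqd (is_derive1_comp (is_derive_cos _) (is_derive_affine a b x)) _).
by rewrite /= ; ring.
Qed.

Lemma is_derive_sin_affine (a b x : R) :
  is_derive x 1 (fun t => sin (a + b * t)) (b * cos (a + b * x)).
Proof.
refine (is_derive_eqd (is_derive1_comp (is_derive_sin _) (is_derive_affine a b x)) _).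
by rewrite /= ; ring.
Qed.

Lemma cder_cexpi (a b x : R) :
  cder (fun t => cexpi (a + b * t)) x (Complex 0 b * cexpi (a + b * x)).
Proof.
split; rewrite !ReIm /=.
  by apply: is_derive_eqd (is_derive_cos_affine _ _ _) _; ring.
by apply: is_derive_eqd (is_derive_sin_affine _ _ _) _; ring.
Qed.

Lemma is_derive_continuous (h : R -> R) x a : is_derive x 1 h a -> {for x, continuous h}.
Proof. by move=> [dh _]; apply/differentiable_continuous/derivable1_diffP. Qed.

Definition ccontinuous f x : Prop :=
  {for x, continuous (fun t => complex.Re (f t))} /\
  {for x, continuous (fun t => complex.Im (f t))}.

Lemma cder_continuous f x d : cder f x d -> ccontinuous f x.
Proof. by move=> [f1 f2]; split; apply: is_derive_continuous; eassumption. Qed.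

Lemma ccontinuousM f g x : ccontinuous f x -> ccontinuous g x ->
  ccontinuous (fun t => f t * g t) x.
Proof.
move=> [f1 f2] [g1 g2]; split.
  rewrite (_ : (fun t => _) = (fun t => complex.Re (f t) * complex.Re (g t) -
    complex.Im (f t) * complex.Im (g t))); last by apply/funext => t; rewrite ReIm.
  by apply: continuousB; apply: continuousM.
rewrite (_ : (fun t => _) = (fun t => complex.Re (f t) * complex.Im (g t) +
  complex.Im (f t) * complex.Re (g t))); last by apply/funext => t; rewrite ReIm.
by apply: continuousD; apply: continuousM.
Qed.

Lemma ccontinuousB f g x : ccontinuous f x -> ccontinuous g x ->
  ccontinuous (fun t => f t - g t) x.
Proof.
move=> [f1 f2] [g1 g2]; split.
  rewrite (_ : (fun t => _) = (fun t => complex.Re (f t) - complex.Re (g t))).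
    exact: continuousB.
  by apply/funext => t; rewrite !ReIm.
rewrite (_ : (fun t => _) = (fun t => complex.Im (f t) - complex.Im (g t))).
  exact: continuousB.
by apply/funext => t; rewrite !ReIm.
Qed.

Lemma near_ccontinuous f g x : (\near x, f x = g x) ->
  ccontinuous f x -> ccontinuous g x.
Proof.
move=> fg [f1 f2]; have fgx := nbhs_singleton fg.
have gf : \near x, g x = f x by apply: filterS fg => y ->.
split; rewrite /prop_for /continuous_at -fgx.
  by apply: cvg_trans f1; apply: near_eq_cvg; apply: filterS gf => y ->.
by apply: cvg_trans f2; apply: near_eq_cvg; apply: filterS gf => y ->.
Qed.

End ComplexCalculus.

(** * Integrals over intervals *)


Lemma integrable_setU (d : measure_display) (T : measurableType d) (R : realType)
    (mu : {measure set T -> \bar R}) (A B : set T) (f : T -> \bar R) :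
  measurable A -> measurable B -> [disjoint A & B] ->
  mu.-integrable A f -> mu.-integrable B f -> mu.-integrable (A `|` B) f.
Proof.
move=> mA mB AB /integrableP[mfA fA] /integrableP[mfB fB].
have mf : measurable_fun (A `|` B) f by apply/measurable_funU.
apply/integrableP; split => //.
rewrite ge0_integral_setU//; first exact: lte_add_pinfty.
exact: measurableT_comp.
Qed.

Section RealIntegration.
Variable R : realType.
Local Notation mu := (@lebesgue_measure R).

Lemma integrable_itv_bndo_bndc (a b : R) (f : R -> R) :
  mu.-integrable `[a, b[ (EFin \o f) -> mu.-integrable `[a, b] (EFin \o f).
Proof.
move=> fi; have [ab|ba] := leP a b; last first.
  rewrite set_itv_ge; first exact: integrable_set0.
  by rewrite bnd_simp -ltNge.
rewrite -[X in _.-integrable X](@setUitv1 _ _ (BLeft a) b true)//.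
apply: integrable_setU => //.
- apply/disj_setPRL => x /= ->; rewrite in_itv/= ltxx andbF.
  by move=> [].
- apply: measurable_bounded_integrable => //.
  + by rewrite [X in (X < _)%E](lebesgue_measure_set1 b) ltry.
  + exact: measurable_fun_set1.
  + exists `|f b|; split => // M bM x /= ->; exact: ltW.
Qed.

Lemma FTC_itvco (H D : R -> R) (a b : R) : a <= b ->
  (forall x, a <= x <= b -> is_derive x 1 H (D x)) ->
  (forall x, a <= x <= b -> {for x, continuous D}) ->
  mu.-integrable `[a, b[ (EFin \o D) /\
  Rintegral mu `[a, b[ D = H b - H a.
Proof.
rewrite le_eqVlt => /predU1P[<-|ab] dH cD.
  rewrite set_itvco0; split; first exact: integrable_set0.
  by rewrite Rintegral_set0 subrr.
have cDw : {within `[a, b], continuous D}.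
  by apply: continuous_in_subspaceT => x /set_mem /=; rewrite in_itv /= => /cD.
have iD : mu.-integrable `[a, b] (EFin \o D).
  by apply: continuous_compact_integrable => //; exact: segment_compact.
have iD' : mu.-integrable `[a, b[ (EFin \o D).
  by apply: integrableS iD => //; by apply: subset_itvl; rewrite bnd_simp.
split => //.
rewrite Rintegral_itv_bndo_bndc// /Rintegral (@continuous_FTC2 _ D H)//.
- split.
  + by move=> x; rewrite in_itv /= => /andP[ax xb]; have [] := dH x _; rewrite // !ltW.
  + apply/cvg_at_right_filter; apply: (is_derive_continuous (dH a _)).
    by rewrite lexx ltW.
  + apply/cvg_at_left_filter; apply: (is_derive_continuous (dH b _)).
    by rewrite lexx ltW.
- move=> x; rewrite in_itv /= => /andP[ax xb]; rewrite derive1E.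
  by have [] := dH x _; rewrite // !ltW.
Qed.

(** The integrand may jump at integers, hence half-open pieces for [h]. Agreement of [F] with [H n]
    on closed pieces encodes the continuity of [F] at integers and makes the increments
    telescope. *)
Lemma piecewise_FTC (h F : R -> R) (H D : nat -> R -> R) :
  (forall n (x : R), n%:R <= x <= n.+1%:R -> is_derive x 1 (H n) (D n x)) ->
  (forall n (x : R), n%:R <= x <= n.+1%:R -> {for x, continuous (D n)}) ->
  (forall n (x : R), n%:R <= x < n.+1%:R -> h x = D n x) ->
  (forall n (x : R), n%:R <= x <= n.+1%:R -> F x = H n x) ->
  forall y, 0 <= y ->
  mu.-integrable `[0, y[ (EFin \o h) /\ Rintegral mu `[0, y[ h = F y - F 0.
Proof.
move=> dH cD hD FH.
have piece n (y : R) : n%:R <= y <= n.+1%:R ->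
    mu.-integrable `[n%:R, y[ (EFin \o h) /\
    Rintegral mu `[n%:R, y[ h = F y - F n%:R.
  move=> /andP[ny yn].
  have hDn : {in [set` `[n%:R, y[], D n =1 h}.
    move=> x /set_mem /=; rewrite in_itv /= => /andP[nx xy].
    by rewrite (hD n)// nx (lt_le_trans xy).
  have [||iD rD] := @FTC_itvco (H n) (D n) n%:R y ny.
  - by move=> x /andP[nx xy]; apply: dH; rewrite nx (le_trans xy).
  - by move=> x /andP[nx xy]; apply: cD; rewrite nx (le_trans xy).
  split.
    by apply: eq_integrable iD => // x xy; rewrite /= hDn.
  have -> : Rintegral mu `[n%:R, y[ h = Rintegral mu `[n%:R, y[ (D n).
    by apply: eq_Rintegral => x xy; rewrite hDn.
  rewrite rD !(FH n) ?ny ?yn//.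
  by rewrite lexx ler_nat leqnSn.
have glue n (y : R) : n%:R <= y <= n.+1%:R ->
    mu.-integrable `[0, n%:R[ (EFin \o h) /\ Rintegral mu `[0, n%:R[ h = F n%:R - F 0 ->
    mu.-integrable `[0, y[ (EFin \o h) /\ Rintegral mu `[0, y[ h = F y - F 0.
  move=> ny [i0 r0]; have [i1 r1] := piece n y ny.
  have E : `[0, y[%classic = `[0, n%:R[%classic `|` `[n%:R, y[%classic :> set R.
    rewrite -itv_bndbnd_setU// !bnd_simp ?ler0n//.
    by case/andP: ny.
  have dj : [disjoint `[0, n%:R[%classic & `[n%:R, y[%classic : set R].
    apply/disj_setPRL => x /=; rewrite !in_itv/= => /andP[nx _] /andP[_].
    by rewrite ltNge nx.
  have iU : mu.-integrable `[0, y[ (EFin \o h).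
    by rewrite E; apply: integrable_setU.
  split => //; rewrite E Rintegral_setU// -?E// r0 r1; ring.
have nat_ok n : mu.-integrable `[0, n%:R[ (EFin \o h) /\
    Rintegral mu `[0, n%:R[ h = F n%:R - F 0.
  elim: n => [|n IH].
    rewrite set_itvco0; split; first exact: integrable_set0.
    by rewrite Rintegral_set0 subrr.
  by apply: glue IH; rewrite lexx ler_nat leqnSn.
move=> y y0; have /andP[ny yn] := truncn_itv y0.
by apply: (glue (Num.truncn y)) => //; rewrite ny ltW.
Qed.

(** An arbitrary solution is known only through its integral equation; this lemma and the next
    recover its continuity, and its derivative wherever the integrand is continuous. *)
Lemma indefinite_integral_continuous (f h : R -> R) (c T : R) :
  (forall x, - T <= x -> mu.-integrable `[- T, x] (EFin \o h) /\
     f x = c + Rintegral mu `[- T, x] h) ->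
  forall x, - T < x -> {for x, continuous f}.
Proof.
move=> fh x Tx.
(* Integrating up to [x + 1] makes [x] an interior point. *)
have [ih _] : mu.-integrable `[- T, x + 1] (EFin \o h) /\ _ := fh (x + 1) ltac:(lra).
have Tx1 : - T < x + 1 by lra.
have cw := parameterized_integral_continuous (ltW Tx1) ih.
have cx : {for x, continuous (fun y => c + Rintegral mu `[- T, y] h)}.
  apply: continuousD; first exact: cst_continuous.
  by apply: (within_continuous_continuous Tx1 cw); rewrite in_itv /=; lra.
apply: cvg_trans; last by rewrite (fh x (ltW Tx)).2; exact: cx.
apply: near_eq_cvg; near=> y; rewrite (fh y _).2//.
by near: y; exact: lt_le_nbhsr.
Unshelve. all: by end_near. Qed.

Lemma indefinite_integral_derive (f h : R -> R) (c T : R) :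
  (forall x, - T <= x -> mu.-integrable `[- T, x] (EFin \o h) /\
     f x = c + Rintegral mu `[- T, x] h) ->
  forall x, - T < x -> {for x, continuous h} -> is_derive x 1 f (h x).
Proof.
move=> fh x Tx ch.
have [ih _] : mu.-integrable `[- T, x + 1] (EFin \o h) /\ _ := fh (x + 1) ltac:(lra).
have xx1 : x < x + 1 by lra.
have [dF F'] := @continuous_FTC1_closed _ h (- T) x _ xx1 ih Tx ch.
have dF' : is_derive x 1 (fun y => Rintegral mu `[- T, y] h) (h x).
  by split; [exact: dF | rewrite -derive1E F'].
have dc : is_derive x 1 (fun y => c + Rintegral mu `[- T, y] h) (h x).
  by refine (is_derive_eqd (is_derive_addr (is_derive_cst c x 1) dF') _); rewrite add0r.
have E : \near x, f x = c + Rintegral mu `[- T, x] h.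
  near=> y; rewrite (fh y _).2//.
  by near: y; exact: lt_le_nbhsr.
by apply: near_eq_is_derive dc; apply: filterS E => y ->.
Unshelve. all: by end_near. Qed.

End RealIntegration.

(** * The system with a piecewise smooth potential *)


Section Conj.
Variable R : realType.
Implicit Types x y : R[i].

Lemma cconjM x y : cconj (x * y) = cconj x * cconj y.
Proof. by case: x y => [a b] [c d]; apply: complex_eq => /=; ring. Qed.

Lemma cconjK x : cconj (cconj x) = x.
Proof. by case: x => [a b]; apply: complex_eq => /=; ring. Qed.

Lemma cconj0 : cconj (0 : R[i]) = 0.
Proof. by apply: complex_eq => /=; rewrite ?oppr0. Qed.

Lemma cconj1 : cconj (1 : R[i]) = 1.
Proof. by apply: complex_eq => /=; rewrite ?oppr0. Qed.

Lemma cconj_cexpi (t : R) : cconj (cexpi t) = cexpi (- t).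
Proof. by apply: complex_eq => /=; rewrite ?cosN ?sinN. Qed.

End Conj.

Section TruncatedFTC.
Variable R : realType.
Local Notation mu := (@lebesgue_measure R).

(** The truncated integrand lives on [[0, T)], so the primitive is frozen outside: its value at [x]
    is that of [F] at the projection of [x] onto [[0, T]]. *)
Lemma truncated_piecewise_FTC (h F : R -> R) (H D : nat -> R -> R) (T : R) (hT : R -> R) :
  (forall n (x : R), n%:R <= x <= n.+1%:R -> is_derive x 1 (H n) (D n x)) ->
  (forall n (x : R), n%:R <= x <= n.+1%:R -> {for x, continuous (D n)}) ->
  (forall n (x : R), n%:R <= x < n.+1%:R -> h x = D n x) ->
  (forall n (x : R), n%:R <= x <= n.+1%:R -> F x = H n x) ->
  0 < T -> (forall s, hT s = if 0 <= s < T then h s else 0) ->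
  forall x, - T <= x -> mu.-integrable `[- T, x] (EFin \o hT) /\
    F (Num.max 0 (Num.min x T)) = F 0 + Rintegral mu `[- T, x] hT.
Proof.
move=> dH cD hD FH T0 hTE x Tx.
have FTC := piecewise_FTC dH cD hD FH.
(* In the three cases below, [A] is the part of [[- T, x]] where [hT] coincides with [h]: empty,
   [[0, x]] or [[0, T)]. *)
have key (A : set R) : measurable A -> mu.-integrable A (EFin \o h) ->
    hT \_ `[- T, x] = h \_ A ->
    mu.-integrable `[- T, x] (EFin \o hT) /\
    Rintegral mu `[- T, x] hT = Rintegral mu A h.
  move=> mA hi E; split; last by rewrite Rintegral_mkcond E -Rintegral_mkcond.
  apply/(integrable_mkcond _ _).2 => //; rewrite restrict_EFin E -restrict_EFin.
  by apply: (iffLR (integrable_mkcond _ _)).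
have [x0|x0] := ltP x 0.
  have [|-> ->] := key set0 measurable0 (integrable_set0 _ _).
    apply/funext => s; rewrite /patch in_set0; case: ifPn => // /set_mem /=.
    by rewrite in_itv /= => /andP[_ sx]; rewrite hTE leNgt (le_lt_trans sx).
  split => //; rewrite Rintegral_set0 addr0; congr F.
  by apply/max_idPl; rewrite ge_min ltW.
have [xT|Tlx] := ltP x T.
  have [hi hr] := FTC x x0.
  have hc := integrable_itv_bndo_bndc hi.
  have [//||-> ->] := key `[0, x]%classic _ hc.
    apply/funext => s; rewrite /patch !mem_setE !in_itv/= hTE.
    have [s0|s0] := ltP s 0; first by rewrite if_same.
    have [sx|sx] := leP s x; last by rewrite andbF.
    by rewrite (le_trans _ s0) ?oppr_le0 ?ltW//= (le_lt_trans sx).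
  split => //; rewrite -Rintegral_itv_bndo_bndc// hr.
  by rewrite (max_idPr _)//; ring.
have [hi hr] := FTC T (ltW T0).
have [//||-> ->] := key `[0, T[%classic _ hi.
  apply/funext => s; rewrite /patch !mem_setE !in_itv/= hTE.
  have [s0|s0] := ltP s 0; first by rewrite if_same.
  have [sT|sT] := ltP s T; last by rewrite if_same.
  by rewrite (le_trans _ s0) ?oppr_le0 ?ltW//= (lt_le_trans sT).
split => //; rewrite hr (max_idPr _) ?ltW//; ring.
Qed.

Lemma constant_of_derive0 (w : R -> R) (a b : R) : a <= b ->
  (forall x, a <= x <= b -> {for x, continuous w}) ->
  (forall x, a < x < b -> is_derive x 1 w 0) -> w b = w a.
Proof.
move=> ab cw dw.
have dw' x : x \in `]a, b[ -> is_derive x 1 w ((fun=> 0) x).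
  by rewrite in_itv /=; exact: dw.
have cw' : {within `[a, b], continuous w}.
  by apply: continuous_in_subspaceT => x /set_mem /=; rewrite in_itv /=; exact: cw.
have [c _ /eqP] := MVT_segment ab dw' cw'.
by rewrite mul0r subr_eq0 => /eqP.
Qed.

Lemma cconstant_of_derive0 (w : R -> R[i]) (a b : R) : a <= b ->
  (forall x, a <= x <= b -> ccontinuous w x) ->
  (forall x, a < x < b -> cder w x 0) -> w b = w a.
Proof.
move=> ab cw dw; apply: complex_eq.
  exact: (constant_of_derive0 ab (fun x xab => (cw x xab).1) (fun x xab => (dw x xab).1)).
exact: (constant_of_derive0 ab (fun x xab => (cw x xab).2) (fun x xab => (dw x xab).2)).
Qed.

End TruncatedFTC.

(** * Existence and uniqueness for a potential that is smooth on each [[n, n + 1]] *)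

Section PiecewisePotential.
Variable R : realType.
Local Notation mu := (@lebesgue_measure R).
Variable p : nat -> R -> R[i].

Definition pot (x : R) : R[i] := if x < 0 then 0 else p (Num.truncn x) x.

Lemma potE n x : n%:R <= x < n.+1%:R -> pot x = p n x.
Proof.
move=> nx; rewrite /pot (truncn_def nx) ltNge (le_trans _ (proj1 (andP nx)))//.
Qed.

Variable k : R.
Variables f g : nat -> R -> R[i].

Let Q n x := p n x * cexpi (k * x).

Hypothesis p_der : forall n (x : R), n%:R <= x <= n.+1%:R -> exists d, cder (p n) x d.
Hypothesis f_der : forall n (x : R), n%:R <= x <= n.+1%:R ->
  cder (f n) x (cconj (Q n x) * g n x).
Hypothesis g_der : forall n (x : R), n%:R <= x <= n.+1%:R ->
  cder (g n) x (Q n x * f n x).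
Hypothesis f_init : forall n, f n n%:R = 1.
Hypothesis g_init : forall n, g n n%:R = 0.

(* [(f n, g n)] solves the system from [(1, 0)]; by symmetry [(cconj g, cconj f)]
   is the solution from [(0, 1)]. *)
Fixpoint ab n : R[i] * R[i] :=
  if n is m.+1 then
    (f m n%:R * (ab m).1 + cconj (g m n%:R) * (ab m).2,
     g m n%:R * (ab m).1 + cconj (f m n%:R) * (ab m).2)
  else (1, 0).

Let Fp n x := f n x * (ab n).1 + cconj (g n x) * (ab n).2.
Let Gp n x := g n x * (ab n).1 + cconj (f n x) * (ab n).2.

Lemma Q_der n (x : R) : n%:R <= x <= n.+1%:R -> exists d, cder (Q n) x d.
Proof.
move=> /p_der[d pd]; eexists; apply: cderM; first exact: pd.
have -> : (fun t => cexpi (k * t)) = (fun t => cexpi (0 + k * t)).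
  by apply/funext => t; rewrite add0r.
exact: cder_cexpi.
Qed.

Lemma Fp_der n (x : R) : n%:R <= x <= n.+1%:R ->
  cder (Fp n) x (cconj (Q n x) * Gp n x).
Proof.
move=> nx; rewrite /Fp; apply: cder_eq.
  apply: cderD; apply: cderM; try exact: cder_cst.
    exact: f_der.
  by apply: cderJ; exact: g_der.
by rewrite !cconjM /Gp; ring.
Qed.

Lemma Gp_der n (x : R) : n%:R <= x <= n.+1%:R ->
  cder (Gp n) x (Q n x * Fp n x).
Proof.
move=> nx; rewrite /Gp; apply: cder_eq.
  apply: cderD; apply: cderM; try exact: cder_cst.
    exact: g_der.
  by apply: cderJ; exact: f_der.
by rewrite cconjM cconjK /Fp; ring.
Qed.

Lemma FGp_init n : Fp n n%:R = (ab n).1 /\ Gp n n%:R = (ab n).2.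
Proof.
by rewrite /Fp /Gp f_init g_init cconj0 cconj1 !mul1r !mul0r addr0 add0r.
Qed.

Lemma FGp_end n : Fp n n.+1%:R = (ab n.+1).1 /\ Gp n n.+1%:R = (ab n.+1).2.
Proof. by []. Qed.

Let F x := Fp (Num.truncn x) x.
Let G x := Gp (Num.truncn x) x.

Lemma FGE n x : n%:R <= x <= n.+1%:R -> F x = Fp n x /\ G x = Gp n x.
Proof.
move=> /andP[nx]; rewrite le_eqVlt => /predU1P[->|xn].
  (* At the right endpoint [truncn] already selects the next piece, whose initial value is by
     construction the end value of this one. *)
  rewrite /F /G (_ : Num.truncn _ = n.+1) ?natrK//.
  by have [-> ->] := FGp_init n.+1.
by rewrite /F /G (@truncn_def _ _ n) ?nx.
Qed.

Lemma FG0 : F 0 = 1 /\ G 0 = 0.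
Proof. by have [|-> ->] := @FGE 0 0; [rewrite lexx ler01|exact: FGp_init]. Qed.

Lemma cintegral_equation (E h : R -> R[i]) (En Dn : nat -> R -> R[i]) (T : R)
    (hT : R -> R[i]) :
  (forall n (x : R), n%:R <= x <= n.+1%:R -> cder (En n) x (Dn n x)) ->
  (forall n (x : R), n%:R <= x <= n.+1%:R -> exists d, cder (Dn n) x d) ->
  (forall n (x : R), n%:R <= x < n.+1%:R -> h x = Dn n x) ->
  (forall n (x : R), n%:R <= x <= n.+1%:R -> E x = En n x) ->
  0 < T -> (forall s, hT s = if 0 <= s < T then h s else 0) ->
  forall x, - T <= x -> cintegrable `[- T, x] hT /\
    E (Num.max 0 (Num.min x T)) = E 0 + cint `[- T, x] hT.
Proof.
move=> dE dD hD EE T0 hTE x Tx.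
have [|||||i1 r1] := @truncated_piecewise_FTC R (fun t => complex.Re (h t))
  (fun t => complex.Re (E t)) (fun n t => complex.Re (En n t))
  (fun n t => complex.Re (Dn n t)) T (fun t => complex.Re (hT t)) _ _ _ _ T0 _ x Tx.
- by move=> n t /dE[].
- by move=> n t /dD[d /cder_continuous[]].
- by move=> n t /hD ->.
- by move=> n t /EE ->.
- by move=> s; rewrite hTE; case: ifP.
have [|||||i2 r2] := @truncated_piecewise_FTC R (fun t => complex.Im (h t))
  (fun t => complex.Im (E t)) (fun n t => complex.Im (En n t))
  (fun n t => complex.Im (Dn n t)) T (fun t => complex.Im (hT t)) _ _ _ _ T0 _ x Tx.
- by move=> n t /dE[].
- by move=> n t /dD[d /cder_continuous[]].
- by move=> n t /hD ->.
- by move=> n t /EE ->.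
- by move=> s; rewrite hTE; case: ifP.
split; first by split.
by apply: complex_eq; rewrite ReIm.
Qed.

Definition sol_mx (T x : R) : 'M[R[i]]_2 :=
  let y := Num.max 0 (Num.min x T) in
  \matrix_(i < 2, j < 2)
    if i == i0 then if j == i0 then F y else cconj (G y)
    else if j == i0 then G y else cconj (F y).

Lemma ord2_ind (P : 'I_2 -> Prop) : P i0 -> P i1 -> forall i, P i.
Proof.
move=> P0 P1 [[|[|//]] lt].
  by rewrite (_ : Ordinal lt = i0) //; apply: val_inj.
by rewrite (_ : Ordinal lt = i1) //; apply: val_inj.
Qed.

Lemma coef_mulE (P : R -> R[i]) (s : R) (M : 'M[R[i]]_2) j :
  (coef_mx P k s *m M) i0 j = cconj (P s * cexpi (k * s)) * M i1 j /\
  (coef_mx P k s *m M) i1 j = (P s * cexpi (k * s)) * M i0 j.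
Proof.
split; rewrite !mxE !big_ord_recl big_ord0 !mxE /= ?cconjM ?cconj_cexpi.
  by rewrite mul0r add0r addr0; congr (_ * M _ j); apply: val_inj.
by rewrite mul0r !addr0; congr (_ * M _ j); apply: val_inj.
Qed.

Lemma sol_mxP (T : R) : 0 < T -> nlft_sol (trunc pot T) T k (sol_mx T).
Proof.
move=> T0; split.
  move=> x xT; rewrite /sol_mx (max_idPl _); last first.
    by rewrite ge_min (le_trans xT)// oppr_le0 ltW.
  apply/matrixP; have [F0 G0] := FG0.
  by apply: ord2_ind; apply: ord2_ind; rewrite !mxE /= ?F0 ?G0 ?cconj0 ?cconj1.
move=> x Tx.
have truncE s : trunc pot T s = if 0 <= s < T then pot s else 0.
  rewrite /trunc; have [s0|s0] := ltP s 0; last by rewrite ger0_norm.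
  by rewrite /pot s0 if_same.
have yE s : 0 <= s < T -> Num.max 0 (Num.min s T) = s.
  by move=> /andP[s0 sT]; rewrite (min_idPl _) ?ltW// (max_idPr _).
have mE s : (sol_mx T s i0 i0 = F (Num.max 0 (Num.min s T))) *
   (sol_mx T s i0 i1 = cconj (G (Num.max 0 (Num.min s T)))) *
   (sol_mx T s i1 i0 = G (Num.max 0 (Num.min s T))) *
   (sol_mx T s i1 i1 = cconj (F (Num.max 0 (Num.min s T)))).
  by rewrite !mxE.
have [F0 G0] := FG0.
have QE n (s : R) : n%:R <= s < n.+1%:R -> pot s * cexpi (k * s) = Q n s.
  by move=> ns; rewrite (potE ns).
have W n (s : R) : n%:R <= s < n.+1%:R -> (n%:R <= s <= n.+1%:R :> Prop).
  by move=> /andP[-> /ltW].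
apply: ord2_ind; apply: ord2_ind.
- have := @cintegral_equation F (fun s => cconj (pot s * cexpi (k * s)) * G s)
    Fp (fun n s => cconj (Q n s) * Gp n s) T
    (fun s => (coef_mx (trunc pot T) k s *m sol_mx T s) i0 i0) _ _ _ _ T0 _ x Tx.
  rewrite mE F0 mxE; apply.
  + exact: Fp_der.
  + move=> n t nt; have [d Qd] := Q_der nt; eexists; apply: cderM.
      by apply: cderJ; exact: Qd.
    exact: Gp_der.
  + by move=> n s ns; rewrite (QE _ _ ns) (FGE (W _ _ ns)).2.
  + by move=> n s ns; rewrite (FGE ns).1.
  + move=> s; rewrite (coef_mulE _ _ _ _).1 truncE mE; case: ifPn => [st|_].
      by rewrite yE.
    by rewrite mul0r cconj0 mul0r.
- have := @cintegral_equation (fun s => cconj (G s))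
    (fun s => cconj (pot s * cexpi (k * s)) * cconj (F s))
    (fun n s => cconj (Gp n s)) (fun n s => cconj (Q n s) * cconj (Fp n s)) T
    (fun s => (coef_mx (trunc pot T) k s *m sol_mx T s) i0 i1) _ _ _ _ T0 _ x Tx.
  rewrite mE G0 mxE cconj0; apply.
  + by move=> n s ns; rewrite -cconjM; apply/cderJ/Gp_der.
  + move=> n t nt; have [d Qd] := Q_der nt; eexists; apply: cderM.
      by apply: cderJ; exact: Qd.
    by apply: cderJ; exact: Fp_der.
  + by move=> n s ns; rewrite (QE _ _ ns) (FGE (W _ _ ns)).1.
  + by move=> n s ns; rewrite (FGE ns).2.
  + move=> s; rewrite (coef_mulE _ _ _ _).1 truncE mE; case: ifPn => [st|_].
      by rewrite yE.
    by rewrite mul0r cconj0 mul0r.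
- have := @cintegral_equation G (fun s => (pot s * cexpi (k * s)) * F s)
    Gp (fun n s => Q n s * Fp n s) T
    (fun s => (coef_mx (trunc pot T) k s *m sol_mx T s) i1 i0) _ _ _ _ T0 _ x Tx.
  rewrite mE G0 mxE; apply.
  + exact: Gp_der.
  + move=> n t nt; have [d Qd] := Q_der nt; eexists; apply: cderM.
      exact: Qd.
    exact: Fp_der.
  + by move=> n s ns; rewrite (QE _ _ ns) (FGE (W _ _ ns)).1.
  + by move=> n s ns; rewrite (FGE ns).2.
  + move=> s; rewrite (coef_mulE _ _ _ _).2 truncE mE; case: ifPn => [st|_].
      by rewrite yE.
    by rewrite !mul0r.
- have := @cintegral_equation (fun s => cconj (F s))
    (fun s => (pot s * cexpi (k * s)) * cconj (G s))
    (fun n s => cconj (Fp n s)) (fun n s => Q n s * cconj (Gp n s)) T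
    (fun s => (coef_mx (trunc pot T) k s *m sol_mx T s) i1 i1) _ _ _ _ T0 _ x Tx.
  rewrite mE F0 mxE cconj1; apply.
  + move=> n s ns; apply: cder_eq; first by apply/cderJ/Fp_der.
    by rewrite cconjM cconjK.
  + move=> n t nt; have [d Qd] := Q_der nt; eexists; apply: cderM.
      exact: Qd.
    by apply: cderJ; exact: Gp_der.
  + by move=> n s ns; rewrite (QE _ _ ns) (FGE (W _ _ ns)).2.
  + by move=> n s ns; rewrite (FGE ns).1.
  + move=> s; rewrite (coef_mulE _ _ _ _).2 truncE mE; case: ifPn => [st|_].
      by rewrite yE.
    by rewrite !mul0r.
Qed.

(** The SU(1,1) conservation law: along the system [|F|^2] and [|G|^2] have the same derivative. *)
Lemma ab_det n : (ab n).1 * cconj (ab n).1 - (ab n).2 * cconj (ab n).2 = 1.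
Proof.
elim: n => [|n IH]; first by rewrite /= cconj1 cconj0; ring.
pose w x := Fp n x * cconj (Fp n x) - Gp n x * cconj (Gp n x).
have dw (x : R) : n%:R <= x <= n.+1%:R -> cder w x 0.
  move=> nx; apply: cder_eq.
    apply: cderB; apply: cderM; try apply: cderJ.
    - exact: Fp_der.
    - exact: Fp_der.
    - exact: Gp_der.
    - exact: Gp_der.
  by cbv beta; move: (Q n x) (Fp n x) (Gp n x) => u v z; rewrite !cconjM cconjK; ring.
have nn : (n%:R : R) <= n.+1%:R by rewrite ler_nat.
have : w n.+1%:R = w n%:R.
  apply: cconstant_of_derive0 nn _ _ => x; first by move=> /dw/cder_continuous.
  by move=> /andP[/ltW a /ltW b]; apply: dw; rewrite a.
rewrite /w; have [-> ->] := FGp_init n; have [-> ->] := FGp_end n.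
by rewrite IH.
Qed.

(** The final statement concerns every family of solutions, so an arbitrary one must be identified
    with the explicit one. Integer [T] and integer points suffice to refute a limit, and an integer
    cut-off leaves each piece below it intact. Wronskians take the place of a Gronwall estimate. *)
Lemma sol_unique (N : nat) (X : R -> 'M[R[i]]_2) :
  nlft_sol (trunc pot N.+1%:R) N.+1%:R k X ->
  forall n, (n <= N.+1)%N -> X n%:R i0 i0 = (ab n).1 /\ X n%:R i1 i0 = (ab n).2.
Proof.
move=> [_ Xeq]; set T := N.+1%:R in Xeq.
have T0 : 0 < T by rewrite ltr0n.
pose P := trunc pot T.
pose a x := X x i0 i0.
pose b x := X x i1 i0.
pose ha s := cconj (P s * cexpi (k * s)) * b s.
pose hb s := (P s * cexpi (k * s)) * a s.
have ea x : - T <= x -> cintegrable `[- T, x] ha /\ a x = 1 + cint `[- T, x] ha.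
  have -> : ha = (fun s => (coef_mx P k s *m X s) i0 i0).
    by apply/funext => s; rewrite (coef_mulE _ _ _ _).1.
  move=> /Xeq /(_ i0 i0)[hi hx]; split; first exact: hi.
  by rewrite /a hx; congr (_ + _); rewrite mxE.
have eb x : - T <= x -> cintegrable `[- T, x] hb /\ b x = 0 + cint `[- T, x] hb.
  have -> : hb = (fun s => (coef_mx P k s *m X s) i1 i0).
    by apply/funext => s; rewrite (coef_mulE _ _ _ _).2.
  move=> /Xeq /(_ i1 i0)[hi hx]; split; first exact: hi.
  by rewrite /b hx; congr (_ + _); rewrite mxE.
have comp (u h : R -> R[i]) c :
    (forall x, - T <= x -> cintegrable `[- T, x] h /\ u x = c + cint `[- T, x] h) ->
    (forall x, - T <= x -> mu.-integrable `[- T, x] (EFin \o (fun t => complex.Re (h t))) /\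
      complex.Re (u x) = complex.Re c + Rintegral mu `[- T, x] (fun t => complex.Re (h t))) /\
    (forall x, - T <= x -> mu.-integrable `[- T, x] (EFin \o (fun t => complex.Im (h t))) /\
      complex.Im (u x) = complex.Im c + Rintegral mu `[- T, x] (fun t => complex.Im (h t))).
  by move=> uh; split=> x /uh[[i1 i2] ->]; rewrite ReIm.
have [ea1 ea2] := comp _ _ _ ea; have [eb1 eb2] := comp _ _ _ eb.
have ca x : - T < x -> ccontinuous a x.
  by move=> Tx; split; [exact: (indefinite_integral_continuous ea1)
                       |exact: (indefinite_integral_continuous ea2)].
have cb x : - T < x -> ccontinuous b x.
  by move=> Tx; split; [exact: (indefinite_integral_continuous eb1)
                       |exact: (indefinite_integral_continuous eb2)].
have PE n (x : R) : (n < N.+1)%N -> n%:R <= x < n.+1%:R -> P x * cexpi (k * x) = Q n x.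
  move=> nN nx; rewrite /P /trunc (potE nx) ger0_norm; last first.
    by rewrite (le_trans _ (proj1 (andP nx))).
  by rewrite (lt_le_trans (proj2 (andP nx))) // ler_nat.
have TN n (x : R) : n%:R <= x -> - T < x.
  by move=> nx; rewrite (lt_le_trans _ nx)// (lt_le_trans (_ : _ < 0)) ?oppr_lt0.
have PQ n (x : R) : (n < N.+1)%N -> n%:R < x < n.+1%:R ->
    \near x, P x * cexpi (k * x) = Q n x.
  move=> nN /andP[nx xn]; near=> y; apply: PE => //; apply/andP; split.
    by near: y; exact: lt_le_nbhsr.
  by near: y; exact: lt_nbhsl.
have da n (x : R) : (n < N.+1)%N -> n%:R < x < n.+1%:R -> cder a x (cconj (Q n x) * b x).
  move=> nN nx; have nx' : n%:R <= x <= n.+1%:R.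
    by case/andP: nx => /ltW -> /ltW ->.
  have Tx := TN _ _ (proj1 (andP nx')).
  have [c1 c2] : ccontinuous ha x.
    apply: (@near_ccontinuous _ (fun t => cconj (Q n t) * b t)).
      by apply: filterS (PQ _ _ nN nx) => y; rewrite /ha => ->.
    apply: ccontinuousM; last exact: cb.
    by have [d Qd] := Q_der nx'; exact: cder_continuous (cderJ Qd).
  have <- : ha x = cconj (Q n x) * b x by rewrite /ha (nbhs_singleton (PQ _ _ nN nx)).
  by split; [exact: (indefinite_integral_derive ea1)
            |exact: (indefinite_integral_derive ea2)].
have db n (x : R) : (n < N.+1)%N -> n%:R < x < n.+1%:R -> cder b x (Q n x * a x).
  move=> nN nx; have nx' : n%:R <= x <= n.+1%:R.
    by case/andP: nx => /ltW -> /ltW ->.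
  have Tx := TN _ _ (proj1 (andP nx')).
  have [c1 c2] : ccontinuous hb x.
    apply: (@near_ccontinuous _ (fun t => Q n t * a t)).
      by apply: filterS (PQ _ _ nN nx) => y; rewrite /hb => ->.
    apply: ccontinuousM; last exact: ca.
    by have [d Qd] := Q_der nx'; exact: cder_continuous Qd.
  have <- : hb x = Q n x * a x by rewrite /hb (nbhs_singleton (PQ _ _ nN nx)).
  by split; [exact: (indefinite_integral_derive eb1)
            |exact: (indefinite_integral_derive eb2)].
elim=> [_|n IH nN].
  have zero (h : R -> R) : mu.-integrable `[- T, 0] (EFin \o h) ->
      (forall s, s < 0 -> h s = 0) -> Rintegral mu `[- T, 0] h = 0.
    (* The potential need not vanish at 0 itself, so this null endpoint is dropped first. *)
    move=> hi h0; rewrite -Rintegral_itv_bndo_bndc; last first.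
      by apply: integrableS hi => //; apply: subset_itvl; rewrite bnd_simp.
    have -> : Rintegral mu `[- T, 0[ h = Rintegral mu `[- T, 0[ (fun=> 0).
      apply: eq_Rintegral => s /set_mem /=; rewrite in_itv /= => /andP[_].
      exact: h0.
    by rewrite Rintegral_cst// mul0r.
  have P0 s : s < 0 -> P s = 0 by move=> s0; rewrite /P /trunc /pot s0 if_same.
  have T0' : - T <= 0 by rewrite oppr_le0 ltW.
  have [[ia1 ia2] ra] := ea 0 T0'; have [[ib1 ib2] rb] := eb 0 T0'.
  rewrite -/(a _) -/(b _) ra rb.
  have -> : cint `[- T, 0] ha = 0.
    apply: complex_eq; apply: zero => // s s0; rewrite /ha P0// mul0r cconj0 mul0r//.
  have -> : cint `[- T, 0] hb = 0.
    by apply: complex_eq; apply: zero => // s s0; rewrite /hb P0// !mul0r.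
  by rewrite !addr0.
have [IHa IHb] := IH (ltnW nN).
have nn : (n%:R : R) <= n.+1%:R by rewrite ler_nat.
(* Wronskians of two solutions are constant, and those of [X] with two independent
   solutions determine [X]. *)
have wronskian (u v : R -> R[i]) :
    (forall x : R, n%:R <= x <= n.+1%:R -> cder u x (cconj (Q n x) * v x)) ->
    (forall x : R, n%:R <= x <= n.+1%:R -> cder v x (Q n x * u x)) ->
    u n.+1%:R * b n.+1%:R - v n.+1%:R * a n.+1%:R =
    u n%:R * b n%:R - v n%:R * a n%:R.
  move=> du dv; pose w x := u x * b x - v x * a x.
  have dw (x : R) : n%:R < x < n.+1%:R -> cder w x 0.
    move=> nx; have nx' : n%:R <= x <= n.+1%:R.
      by case/andP: nx => /ltW -> /ltW ->.
    apply: cder_eq.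
      apply: cderB; apply: cderM.
      - exact: (du x nx').
      - exact: (db n x nN nx).
      - exact: (dv x nx').
      - exact: (da n x nN nx).
    by ring.
  have cw (x : R) : n%:R <= x <= n.+1%:R -> ccontinuous w x.
    move=> nx; have Tx := TN _ _ (proj1 (andP nx)).
    apply: ccontinuousB; apply: ccontinuousM.
    - exact: cder_continuous (du _ nx).
    - exact: cb.
    - exact: cder_continuous (dv _ nx).
    - exact: ca.
  exact: (cconstant_of_derive0 nn cw dw).
have W1 := wronskian _ _ (@Fp_der n) (@Gp_der n).
have W2 : cconj (Gp n n.+1%:R) * b n.+1%:R - cconj (Fp n n.+1%:R) * a n.+1%:R =
    cconj (Gp n n%:R) * b n%:R - cconj (Fp n n%:R) * a n%:R.
  apply: (wronskian (fun x => cconj (Gp n x)) (fun x => cconj (Fp n x))) => x nx.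
    by rewrite -cconjM; apply/cderJ/Gp_der.
  by apply: cder_eq; [apply/cderJ/Fp_der|rewrite cconjM cconjK].
have [Fi Gi] := FGp_init n; have [Fe Ge] := FGp_end n.
rewrite Fi Gi Fe Ge /a /b IHa IHb in W1 W2.
have det0 := ab_det n; have det1 := ab_det n.+1.
move: W1 W2 det0 det1.
move: (X n.+1%:R i0 i0) (X n.+1%:R i1 i0) => a1 b1.
move: (ab n) (ab n.+1) => [u v] [u' v'] /= W1 W2 det0 det1.
(* The two Wronskian identities form a linear system for [a1] and [b1] whose determinant is 1 by
   [det1]; it is solved by Cramer's rule. *)
have {}W1 : u' * b1 = v' * a1 by apply/eqP; rewrite -subr_eq0 W1; apply/eqP; ring.
have {}W2 : cconj u' * a1 = 1 + cconj v' * b1.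
  transitivity (cconj v' * b1 - (cconj v' * b1 - cconj u' * a1)); first by ring.
  by rewrite W2 -det0; ring.
split.
  rewrite -[a1]mul1r -det1.
  transitivity (u' * (cconj u' * a1) - cconj v' * (v' * a1)); first by ring.
  by rewrite W2 -W1; ring.
rewrite -[b1]mul1r -det1.
transitivity (cconj u' * (u' * b1) - v' * (cconj v' * b1)); first by ring.
rewrite W1; transitivity (v' * (cconj u' * a1) - v' * (cconj v' * b1)); first by ring.
by rewrite W2; ring.
Unshelve. all: by end_near. Qed.

End PiecewisePotential.

(** * Explicit solutions on one piece *)


Section Pieces.
Variable R : realType.

(** With [gsin]: the solutions of [y'' = l y] with data (1, 0) and (0, 1) at 0, kept real for either
    sign of [l]. *)
Definition gcos (l x : R) : R :=
  if l < 0 then cos (Num.sqrt (- l) * x)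
  else (expR (Num.sqrt l * x) + expR (- Num.sqrt l * x)) / 2.

Definition gsin (l x : R) : R :=
  if l < 0 then sin (Num.sqrt (- l) * x) / Num.sqrt (- l)
  else if l == 0 then x
  else (expR (Num.sqrt l * x) - expR (- Num.sqrt l * x)) / (2 * Num.sqrt l).

Lemma gcos0 l : gcos l 0 = 1.
Proof. by rewrite /gcos !mulr0 cos0 expR0; case: ifP => // _; lra. Qed.

Lemma gsin0 l : gsin l 0 = 0.
Proof.
rewrite /gsin !mulr0 sin0 expR0 mul0r subrr mul0r.
by case: ifP => // _; case: ifP.
Qed.

Lemma is_derive_expR_lin (b x : R) : is_derive x 1 (fun t => expR (b * t)) (b * expR (b * x)).
Proof.
have := is_derive1_comp (is_derive_expR (b * x))
  (is_derive_mulr (is_derive_cst b x 1) (is_derive_id x 1)).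
by move=> /is_derive_eqd; apply; rewrite /=; ring.
Qed.

Lemma is_derive_cos_lin (b x : R) : is_derive x 1 (fun t => cos (b * t)) (- b * sin (b * x)).
Proof.
have := is_derive_cos_affine 0 b x; rewrite add0r.
by under eq_fun do rewrite add0r.
Qed.

Lemma is_derive_sin_lin (b x : R) : is_derive x 1 (fun t => sin (b * t)) (b * cos (b * x)).
Proof.
have := is_derive_sin_affine 0 b x; rewrite add0r.
by under eq_fun do rewrite add0r.
Qed.

Lemma is_derive_mulcr (h : R -> R) (x a c : R) : is_derive x 1 h a ->
  is_derive x 1 (fun t => h t * c) (a * c).
Proof.
move=> ha; refine (is_derive_eqd (is_derive_mulr ha (is_derive_cst c x 1)) _).
by rewrite mulr0 addr0.
Qed.

Lemma is_derive_gcos (l x : R) : is_derive x 1 (gcos l) (l * gsin l x).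
Proof.
rewrite /gcos /gsin; case: ltP => l0.
  have w0 : 0 < Num.sqrt (- l) by rewrite sqrtr_gt0 oppr_gt0.
  refine (is_derive_eqd (is_derive_cos_lin _ _) _).
  set w := Num.sqrt (- l) in w0 *.
  have E : l = - w ^+ 2 by rewrite sqr_sqrtr ?opprK// oppr_ge0 ltW.
  transitivity (- w ^+ 2 * (sin (w * x) / w)); last by rewrite -E.
  by field; rewrite gt_eqF.
case: eqP => [->|/eqP l1].
  rewrite mul0r sqrtr0 oppr0.
  have -> : (fun t : R => (expR (0 * t) + expR (0 * t)) / 2) = (fun=> (1 + 1) / 2).
    by apply/funext => t; rewrite mul0r expR0.
  exact: is_derive_cst.
have w0 : 0 < Num.sqrt l by rewrite sqrtr_gt0 lt_neqAle eq_sym l1.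
refine (is_derive_eqd (is_derive_mulcr _ (is_derive_addr (is_derive_expR_lin _ _)
  (is_derive_expR_lin _ _))) _).
set w := Num.sqrt l in w0 *.
have E : l = w ^+ 2 by rewrite sqr_sqrtr.
transitivity (w ^+ 2 * ((expR (w * x) - expR (- w * x)) / (2 * w))); last by rewrite -E.
by field; rewrite gt_eqF.
Qed.

Lemma is_derive_gsin (l x : R) : is_derive x 1 (gsin l) (gcos l x).
Proof.
rewrite /gcos /gsin; case: ltP => l0.
  have w0 : 0 < Num.sqrt (- l) by rewrite sqrtr_gt0 oppr_gt0.
  refine (is_derive_eqd (is_derive_mulcr _ (is_derive_sin_lin _ _)) _).
  by field; rewrite gt_eqF.
case: eqP => [->|/eqP l1].
  refine (is_derive_eqd (is_derive_id x 1) _).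
  by rewrite sqrtr0 oppr0 !mul0r expR0; lra.
have w0 : 0 < Num.sqrt l by rewrite sqrtr_gt0 lt_neqAle eq_sym l1.
refine (is_derive_eqd (is_derive_mulcr _ (is_derive_subr (is_derive_expR_lin _ _)
  (is_derive_expR_lin _ _))) _).
by field; rewrite gt_eqF.
Qed.

Lemma is_derive_shift (h : R -> R) (x a b : R) : is_derive (x - b) 1 h a ->
  is_derive x 1 (fun t => h (t - b)) a.
Proof.
move=> ha.
have hs : is_derive x 1 (fun t => t - b) 1.
  refine (is_derive_eqd (is_derive_subr (is_derive_id x 1) (is_derive_cst b x 1)) _).
  by rewrite subr0.
by refine (is_derive_eqd (@is_derive1_comp _ h (fun t => t - b) x _ _ ha hs) _); rewrite mulr1.
Qed.

Lemma cexpiD (a b : R) : cexpi (a + b) = cexpi a * cexpi b.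
Proof. by apply: complex_eq; rewrite ReIm /= ?cosD ?sinD; ring. Qed.

Lemma cexpi0 : cexpi 0 = 1 :> R[i].
Proof. by rewrite /cexpi cos0 sin0. Qed.

(** This is [c e^(-i (Phi + kap (x - t0)))]: phase [Phi] at [t0] and constant frequency [kap], with
    the exponent written in the affine form of [cder_cexpi]. *)
Definition chirp (c kap Phi t0 x : R) : R[i] :=
  c%:C%C * cexpi ((kap * t0 - Phi) + (- kap) * x).

(** In the frame rotating at half the detuning [s], the coefficient matrix is constant, with rows
    [(i s / 2, c)] and [(c, - i s / 2)]. Its square is [l] times the identity, so its exponential is
    [gcos] plus [gsin] times the matrix; [chirp_f] and [chirp_g] form the first column. *)
Definition chirp_f (c s t0 x : R) : R[i] :=
  let l := c ^+ 2 - s ^+ 2 / 4 in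
  cexpi (s / 2 * t0 + (- (s / 2)) * x) *
  Complex (gcos l (x - t0)) (s / 2 * gsin l (x - t0)).

Definition chirp_g (c s psi t0 x : R) : R[i] :=
  let l := c ^+ 2 - s ^+ 2 / 4 in
  cexpi ((psi - s / 2 * t0) + s / 2 * x) * (c * gsin l (x - t0))%:C%C.

Lemma chirp_der (c kap Phi t0 x : R) : exists d, cder (chirp c kap Phi t0) x d.
Proof.
eexists; apply: cderM; [exact: cder_cst|exact: cder_cexpi].
Qed.

Lemma cder_pair (h1 h2 : R -> R) (x a b : R) : is_derive x 1 h1 a -> is_derive x 1 h2 b ->
  cder (fun t => Complex (h1 t) (h2 t)) x (Complex a b).
Proof. by split. Qed.

Lemma chirp_f_der (c kap Phi t0 k x : R) :
  cder (chirp_f c (k - kap) t0) x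
    (cconj (chirp c kap Phi t0 x * cexpi (k * x)) *
     chirp_g c (k - kap) (k * t0 - Phi) t0 x).
Proof.
rewrite /chirp_f /chirp_g /chirp; set s := k - kap; set l := c ^+ 2 - _.
apply: cder_eq.
  apply: cderM; first exact: cder_cexpi.
  exact: (cder_pair (is_derive_shift (is_derive_gcos l (x - t0)))
    (is_derive_mulr (is_derive_cst (s / 2) x 1) (is_derive_shift (is_derive_gsin l (x - t0))))).
cbv beta; set C := gcos l (x - t0); set S := gsin l (x - t0).
have -> : cconj (c%:C%C * cexpi (kap * t0 - Phi + - kap * x) * cexpi (k * x)) *
   (cexpi (k * t0 - Phi - s / 2 * t0 + s / 2 * x) * (c * S)%:C%C) =
   cexpi (s / 2 * t0 + - (s / 2) * x) * (c ^+ 2 * S)%:C%C.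
  have -> : c%:C%C * cexpi (kap * t0 - Phi + - kap * x) * cexpi (k * x) =
     c%:C%C * cexpi ((k * t0 - Phi - s / 2 * t0 + s / 2 * x) -
       (s / 2 * t0 + - (s / 2) * x)).
    by rewrite -mulrA -cexpiD; congr (_ * cexpi _); rewrite /s; field.
  rewrite cconjM cconj_cexpi opprB cexpiD; move: (cexpi (s / 2 * t0 + _)) => z.
  set y := (k * t0 - _ - _ + _).
  have : cexpi (- y) * cexpi y = 1 by rewrite -cexpiD addNr cexpi0.
  move: (cexpi (- y)) (cexpi y) => u v uv.
  transitivity (u * v * (cconj c%:C%C * z * (c * S)%:C%C)); first by ring.
  by rewrite uv; case: z => z1 z2; apply: complex_eq; rewrite !ReIm /=; ring.
move: (cexpi _) => [z1 z2].
by apply: complex_eq; rewrite !ReIm /= /l; field.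
Qed.

Lemma chirp_g_der (c kap Phi t0 k x : R) :
  cder (chirp_g c (k - kap) (k * t0 - Phi) t0) x
    (chirp c kap Phi t0 x * cexpi (k * x) * chirp_f c (k - kap) t0 x).
Proof.
rewrite /chirp_f /chirp_g /chirp; set s := k - kap; set l := c ^+ 2 - _.
apply: cder_eq.
  apply: cderM; first exact: cder_cexpi.
  apply: cder_real.
  exact: (is_derive_mulr (is_derive_cst c x 1) (is_derive_shift (is_derive_gsin l _))).
cbv beta; set C := gcos l (x - t0); set S := gsin l (x - t0).
have -> : c%:C%C * cexpi (kap * t0 - Phi + - kap * x) * cexpi (k * x) *
   (cexpi (s / 2 * t0 + - (s / 2) * x) * Complex C (s / 2 * S)) =
   cexpi (k * t0 - Phi - s / 2 * t0 + s / 2 * x) * (c%:C%C * Complex C (s / 2 * S)).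
  transitivity (cexpi (kap * t0 - Phi + - kap * x) * cexpi (k * x) *
    cexpi (s / 2 * t0 + - (s / 2) * x) * (c%:C%C * Complex C (s / 2 * S))).
    by ring.
  by rewrite -!cexpiD; congr (cexpi _ * _); rewrite /s; field.
move: (cexpi _) => [z1 z2].
by apply: complex_eq; rewrite !ReIm /=; ring.
Qed.

Lemma chirp_f_init (c s t0 : R) : chirp_f c s t0 t0 = 1.
Proof.
rewrite /chirp_f subrr gcos0 gsin0 mulr0 (_ : _ + _ = 0); last by ring.
by rewrite cexpi0 mul1r.
Qed.

Lemma chirp_g_init (c s psi t0 : R) : chirp_g c s psi t0 t0 = 0.
Proof. by rewrite /chirp_g subrr gsin0 !mulr0. Qed.

Definition hyp (x : R) : R[i] := ((1 + x)^-1)%:C%C.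

(* The potential [1 / (1 + x)] makes the Schroedinger equation satisfied by
   [e^(ikx/2) a + e^(-ikx/2) b] free, whence a solution in closed form. *)
Definition hyp_R (kap x : R) : R :=
  if kap == 0 then - x ^+ 3 / 3
  else (x * gcos (- kap ^+ 2) x - gsin (- kap ^+ 2) x) / kap ^+ 2.

Lemma hyp_RE kap x : kap ^+ 2 * hyp_R kap x =
  x * gcos (- kap ^+ 2) x - gsin (- kap ^+ 2) x.
Proof.
rewrite /hyp_R; case: eqP => [->|/eqP k0]; last by field.
rewrite expr0n /= oppr0 mul0r /gcos /gsin ltxx eqxx sqrtr0 oppr0 mul0r expR0.
by field.
Qed.

Lemma is_derive_hyp_R (kap x : R) :
  is_derive x 1 (hyp_R kap) (- x * gsin (- kap ^+ 2) x).
Proof.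
rewrite /hyp_R; case: eqP => [->|/eqP k0].
  rewrite expr0n /= oppr0 /gsin ltxx eqxx.
  refine (is_derive_eqd (is_derive_mulcr _ (is_deriveN (is_deriveX 3 (is_derive_id x 1)))) _).
  by rewrite /GRing.scale /=; field.
refine (is_derive_eqd (is_derive_mulcr _ (is_derive_subr (is_derive_mulr (is_derive_id x 1)
  (is_derive_gcos _ _)) (is_derive_gsin _ _))) _).
by rewrite /=; field.
Qed.

(** [hyp_u] and [hyp_v] are the sum and the difference of [e^(i kap x) a] and [e^(-i kap x) b]; in
    these unknowns the system has the real potential on the diagonal. [hyp_R] is minus the integral
    of [t * gsin] from 0 to [x], which the imaginary part of [hyp_v] needs also at [kap = 0]. *)
Definition hyp_u (kap x : R) : R[i] :=
  let C := gcos (- kap ^+ 2) x in let S := gsin (- kap ^+ 2) x in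
  Complex (C + S) (kap * S).

Definition hyp_v (kap x : R) : R[i] :=
  let C := gcos (- kap ^+ 2) x in let S := gsin (- kap ^+ 2) x in
  Complex (C - (1 + x)^-1 * S) (kap * (S - (1 + x)^-1 * hyp_R kap x)).

Definition hyp_f (k x : R) : R[i] :=
  cexpi (0 + (- (k / 2)) * x) * ((2^-1)%:C%C * (hyp_u (k / 2) x + hyp_v (k / 2) x)).

Definition hyp_g (k x : R) : R[i] :=
  cexpi (0 + k / 2 * x) * ((2^-1)%:C%C * (hyp_u (k / 2) x - hyp_v (k / 2) x)).

Lemma is_derive_inv1 (x : R) : 0 <= x ->
  is_derive x 1 (fun t => (1 + t)^-1) (- (1 + x)^-1 ^+ 2).
Proof.
move=> x0; have x1 : 1 + x != 0 by lra.
have d1 : is_derive x 1 (fun t : R => 1 + t) 1.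
  refine (is_derive_eqd (is_derive_addr (is_derive_cst (1 : R) x 1) (is_derive_id x 1)) _).
  by rewrite add0r.
refine (is_derive_eqd (is_deriveV x1 d1) _).
by rewrite /GRing.scale /= mulr1 exprVn.
Qed.

Lemma hyp_der x : 0 <= x -> exists d, cder hyp x d.
Proof. by move=> x0; eexists; apply: cder_real; exact: is_derive_inv1. Qed.

Lemma hyp_u_der kap x : 0 <= x ->
  cder (hyp_u kap) x ((1 + x)^-1%:C%C * hyp_u kap x + Complex 0 kap * hyp_v kap x).
Proof.
move=> x0; have x1 : 1 + x != 0 by lra.
apply: cder_eq.
  exact: (cder_pair (is_derive_addr (is_derive_gcos _ x) (is_derive_gsin _ x))
    (is_derive_mulr (is_derive_cst kap x 1) (is_derive_gsin _ x))).
have E := hyp_RE kap x.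
rewrite /hyp_u /hyp_v; move: (hyp_R _ _) (gcos _ _) (gsin _ _) E => r C S E.
apply: complex_eq; rewrite !ReIm /=; last by field.
transitivity ((1 + x)^-1 * (C + S) - kap ^+ 2 * S + (1 + x)^-1 * (kap ^+ 2 * r)).
  by rewrite E; field.
by ring.
Qed.

Lemma hyp_v_der kap x : 0 <= x ->
  cder (hyp_v kap) x (- (1 + x)^-1%:C%C * hyp_v kap x + Complex 0 kap * hyp_u kap x).
Proof.
move=> x0; have x1 : 1 + x != 0 by lra.
apply: cder_eq.
  exact: (cder_pair
    (is_derive_subr (is_derive_gcos _ x)
      (is_derive_mulr (is_derive_inv1 x0) (is_derive_gsin _ x)))
    (is_derive_mulr (is_derive_cst kap x 1) (is_derive_subr (is_derive_gsin _ x)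
      (is_derive_mulr (is_derive_inv1 x0) (is_derive_hyp_R kap x))))).
rewrite /hyp_u /hyp_v; move: (hyp_R _ _) (gcos _ _) (gsin _ _) => r C S.
by apply: complex_eq; rewrite !ReIm /=; field.
Qed.

Lemma hyp_f_der k x : 0 <= x ->
  cder (hyp_f k) x (cconj (hyp x * cexpi (k * x)) * hyp_g k x).
Proof.
move=> x0; apply: cder_eq.
  apply: cderM; first exact: cder_cexpi.
  apply: cderM; first exact: cder_cst.
  by apply: cderD; [exact: hyp_u_der|exact: hyp_v_der].
cbv beta; rewrite /hyp_g /hyp cconjM cconj_cexpi.
have -> : k * x = k / 2 * x + k / 2 * x by field.
rewrite !add0r (mulNr (k / 2)) opprD cexpiD.
have : cexpi (- (k / 2 * x)) * cexpi (k / 2 * x) = 1 by rewrite -cexpiD addNr cexpi0.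
move: (cexpi (- (k / 2 * x))) (cexpi (k / 2 * x)) (hyp_u _ _) (hyp_v _ _) ((1 + x)^-1) => z w u v r zw.
transitivity (z * w * z * (2^-1%:C%C * (u - v)) * r%:C%C); last first.
  by rewrite (_ : cconj r%:C%C = r%:C%C); [ring|apply: complex_eq; rewrite /= ?oppr0].
rewrite zw (_ : Complex 0 (- (k / 2)) = - Complex 0 (k / 2)); last first.
  by apply: complex_eq; rewrite /= ?oppr0.
by move: (Complex 0 (k / 2)) (2^-1%:C%C) (r%:C%C) => I h r'; ring.
Qed.

Lemma hyp_g_der k x : 0 <= x ->
  cder (hyp_g k) x (hyp x * cexpi (k * x) * hyp_f k x).
Proof.
move=> x0; apply: cder_eq.
  apply: cderM; first exact: cder_cexpi.
  apply: cderM; first exact: cder_cst.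
  by apply: cderB; [exact: hyp_u_der|exact: hyp_v_der].
cbv beta; rewrite /hyp_f /hyp.
have -> : k * x = k / 2 * x + k / 2 * x by field.
rewrite !add0r (mulNr (k / 2)) cexpiD.
have : cexpi (- (k / 2 * x)) * cexpi (k / 2 * x) = 1 by rewrite -cexpiD addNr cexpi0.
move: (cexpi (k / 2 * x)) (cexpi _) (hyp_u _ _) (hyp_v _ _) ((1 + x)^-1) =>
  w z u v r zw.
transitivity (z * w * w * (2^-1%:C%C * (u + v)) * r%:C%C); last by ring.
rewrite zw.
by move: (Complex 0 (k / 2)) (2^-1%:C%C) (r%:C%C) => I h r'; ring.
Qed.

Lemma hyp_f_init k : hyp_f k 0 = 1.
Proof.
rewrite /hyp_f mulr0 addr0 cexpi0 /hyp_u /hyp_v gcos0 gsin0.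
have -> : hyp_R (k / 2) 0 = 0.
  by rewrite /hyp_R gsin0 expr0n /= !mul0r subr0 oppr0 !mul0r if_same.
by apply: complex_eq; rewrite !ReIm /=; field.
Qed.

Lemma hyp_g_init k : hyp_g k 0 = 0.
Proof.
rewrite /hyp_g mulr0 addr0 cexpi0 /hyp_u /hyp_v gcos0 gsin0.
have -> : hyp_R (k / 2) 0 = 0.
  by rewrite /hyp_R gsin0 expr0n /= !mul0r subr0 oppr0 !mul0r if_same.
by apply: complex_eq; rewrite !ReIm /=; field.
Qed.

End Pieces.

(** * One step in an approximate eigenbasis *)


Section Cabs.
Variable R : realType.
Implicit Types x y z : R[i].

Lemma cabsE x : cabs x = ComplexField.Normc.normc x.
Proof. by case: x. Qed.

Lemma cabs_ge0 x : 0 <= cabs x.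
Proof. exact: sqrtr_ge0. Qed.

Lemma cabsM x y : cabs (x * y) = cabs x * cabs y.
Proof. by rewrite !cabsE ComplexField.Normc.normcM. Qed.

Lemma cabsD x y : cabs (x + y) <= cabs x + cabs y.
Proof. by rewrite !cabsE; exact: le_normcD. Qed.

Lemma cabsN x : cabs (- x) = cabs x.
Proof. by rewrite !cabsE; exact: normcN. Qed.

Lemma cabsB x y : cabs (x - y) <= cabs x + cabs y.
Proof. by rewrite -(cabsN y); exact: cabsD. Qed.

Lemma cabs_sub_trans y x z : cabs (x - z) <= cabs (x - y) + cabs (y - z).
Proof. by rewrite (_ : x - z = (x - y) + (y - z)); [exact: cabsD|ring]. Qed.

Lemma cabs_lerB x y : cabs x - cabs y <= cabs (x - y).
Proof. by rewrite lerBlDr -[X in cabs X <= _](subrK y); exact: cabsD. Qed.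

Lemma cabs_cexpi (t : R) : cabs (cexpi t) = 1.
Proof. by rewrite /cabs /= cos2Dsin2 sqrtr1. Qed.

Lemma cabs_real (t : R) : cabs t%:C%C = `|t|.
Proof. by rewrite /cabs /= expr0n /= addr0 sqrtr_sqr. Qed.

Lemma cabs0 : cabs (0 : R[i]) = 0.
Proof. by rewrite cabsE ComplexField.Normc.normc0. Qed.

Lemma cabs_imag (t : R) : cabs (Complex 0 t) = `|t|.
Proof. by rewrite /cabs /= expr0n /= add0r sqrtr_sqr. Qed.

Lemma cabs_sqr x : cabs x ^+ 2 = complex.Re x ^+ 2 + complex.Im x ^+ 2.
Proof. by rewrite sqr_sqrtr// addr_ge0 ?sqr_ge0. Qed.

Lemma cabs_geRe x : `|complex.Re x| <= cabs x.
Proof.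
rewrite -(ler_pXn2r (ltn0Sn 1)) ?nnegrE ?cabs_ge0//.
by rewrite cabs_sqr real_normK ?num_real// lerDl sqr_ge0.
Qed.

End Cabs.

Section Close.
Variable R : realType.
Implicit Types e x y z : R.

(** Closeness of logarithms: errors add along a chain of steps, and lower bounds are transported as
    well as upper ones. *)
Definition mclose e x y : Prop := x <= expR e * y /\ y <= expR e * x.

Lemma mclose_refl x : mclose 0 x x.
Proof. by rewrite /mclose expR0 mul1r. Qed.

Lemma mclose_trans y e e' x z : mclose e x y -> mclose e' y z -> mclose (e + e') x z.
Proof.
move=> [xy yx] [yz zy]; split.
  by rewrite expRD -mulrA (le_trans xy)// ler_pM2l ?expR_gt0.
by rewrite addrC expRD -mulrA (le_trans zy)// ler_pM2l ?expR_gt0.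
Qed.

Lemma mclose_le e e' x y : 0 <= x -> 0 <= y -> e <= e' -> mclose e x y -> mclose e' x y.
Proof.
move=> x0 y0 ee [xy yx]; split.
  by rewrite (le_trans xy)// ler_wpM2r// ler_expR.
by rewrite (le_trans yx)// ler_wpM2r// ler_expR.
Qed.

Lemma mclose_lin e x y : 0 <= x -> 0 <= y ->
  x <= (1 + e) * y -> y <= (1 + e) * x -> mclose e x y.
Proof.
move=> x0 y0 xy yx; split.
  by rewrite (le_trans xy)// ler_wpM2r// expR_ge1Dx.
by rewrite (le_trans yx)// ler_wpM2r// expR_ge1Dx.
Qed.

End Close.

Section Step.
Variable R : realType.
Implicit Types (c s t w : R) (a b : R[i]).

(* The propagator over a unit interval with amplitude [c] and detuning [s], acting on
   [e^(i psi / 2) a] and [e^(- i psi / 2) b] where [psi] is the phase of [q e^(ikx)]. *)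
Definition step c s a b : R[i] * R[i] :=
  let l := c ^+ 2 - s ^+ 2 / 4 in
  let C := gcos l 1 in let S := gsin l 1 in
  (Complex C (s / 2 * S) * a + (c * S)%:C%C * b,
   (c * S)%:C%C * a + Complex C (- (s / 2 * S)) * b).

Definition gz t a b : R[i] := a - Complex 0 t * b.
Definition gw t a b : R[i] := b + Complex 0 t * a.
Definition gZ t a b : R := cabs (gz t a b) + cabs (gw t a b).
Definition nrm a b : R := cabs a + cabs b.

Lemma gZ_ge0 t a b : 0 <= gZ t a b.
Proof. by rewrite addr_ge0 ?cabs_ge0. Qed.

Lemma nrm_ge0 a b : 0 <= nrm a b.
Proof. by rewrite addr_ge0 ?cabs_ge0. Qed.

Lemma gZ0 a b : gZ 0 a b = nrm a b.
Proof.
have E : Complex 0 0 = 0 :> R[i] by [].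
by rewrite /gZ /gz /gw E !mul0r subr0 addr0.
Qed.

(** For small [t] the eigenbasis is well conditioned: each coordinate differs from [a] or [b] by at
    most half of the other one. *)
Lemma nrm_le_gZ t a b : `|t| <= 2^-1 -> nrm a b <= 2 * gZ t a b.
Proof.
move=> t2; have := cabs_lerB a (Complex 0 t * b).
have := cabs_lerB b (- (Complex 0 t * a)).
rewrite opprK cabsN !cabsM !cabs_imag -/(gz t a b) -/(gw t a b) => h1 h2.
have := ler_wpM2r (cabs_ge0 a) t2; have := ler_wpM2r (cabs_ge0 b) t2.
by rewrite /nrm /gZ; lra.
Qed.

Lemma gZ_change t t' a b : gZ t' a b <= gZ t a b + `|t - t'| * nrm a b.
Proof.
have -> : gZ t' a b = cabs (gz t a b + Complex 0 (t - t') * b) +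
    cabs (gw t a b + - (Complex 0 (t - t') * a)).
  by congr (cabs _ + cabs _); case: a b => [? ?] [? ?]; apply: complex_eq;
    rewrite /gz /gw !ReIm /=; ring.
have := cabsD (gz t a b) (Complex 0 (t - t') * b).
have := cabsD (gw t a b) (- (Complex 0 (t - t') * a)).
by rewrite cabsN !cabsM !cabs_imag /gZ /nrm mulrDr; lra.
Qed.

Lemma gZ_mclose t t' a b : `|t| <= 2^-1 -> `|t'| <= 2^-1 ->
  mclose (2 * `|t - t'|) (gZ t a b) (gZ t' a b).
Proof.
move=> ht ht'; apply: mclose_lin; rewrite ?gZ_ge0//.
  have := gZ_change t' t a b; have := nrm_le_gZ a b ht'.
  rewrite (distrC t') => h1 h2; have := ler_wpM2l (normr_ge0 (t - t')) h1.
  by lra.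
have := gZ_change t t' a b; have := nrm_le_gZ a b ht.
move=> h1 h2; have := ler_wpM2l (normr_ge0 (t - t')) h1.
by lra.
Qed.

(* [gz t] and [gw t] are the coordinates in the eigenbasis of [step c s]. *)
Lemma elliptic_step c s t w a b : w != 0 -> w ^+ 2 = s ^+ 2 / 4 - c ^+ 2 ->
  t * (s / 2 + w) = c -> t * c = s / 2 - w ->
  gz t (step c s a b).1 (step c s a b).2 = cexpi w * gz t a b /\
  gw t (step c s a b).1 (step c s a b).2 = cexpi (- w) * gw t a b.
Proof.
move=> w0 w2 tc tc'; rewrite /step.
set l := c ^+ 2 - _.
have lw : - l = w ^+ 2 by rewrite w2 /l; ring.
have l0 : l < 0 by rewrite -oppr_gt0 lw exprn_even_gt0.
have -> : gcos l 1 = cos w.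
  rewrite /gcos l0 lw sqrtr_sqr mulr1.
  by have [w1|w1] := ger0P w; rewrite ?cosN.
have -> : gsin l 1 = sin w / w.
  rewrite /gsin l0 lw sqrtr_sqr mulr1.
  by have [w1|w1] := ger0P w; rewrite // sinN invrN mulrNN.
set X := c * _; set Y := s / 2 * _.
have E1 : X - t * Y = t * sin w by rewrite /X /Y -tc; field.
have E2 : Y - t * X = sin w by rewrite /Y /X !mulrA tc'; field.
have Ec : cexpi (- w) = Complex (cos w) (- sin w) by rewrite /cexpi cosN sinN.
rewrite Ec /cexpi /gz /gw; move: (cos w) (sin w) X Y E1 E2 => C sn X Y E1 E2.
case: a b => [a1 a2] [b1 b2]; split; apply: complex_eq; rewrite !ReIm /=.
- transitivity (C * a1 + t * C * b2 + (X - t * Y) * b1 - (Y - t * X) * a2); first by ring.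
  by rewrite E1 E2; ring.
- transitivity (C * a2 - t * C * b1 + (X - t * Y) * b2 + (Y - t * X) * a1); first by ring.
  by rewrite E1 E2; ring.
- transitivity (C * b1 - t * C * a2 + (X - t * Y) * a1 + (Y - t * X) * b2); first by ring.
  by rewrite E1 E2; ring.
- transitivity (C * b2 + t * C * a1 + (X - t * Y) * a2 - (Y - t * X) * b1); first by ring.
  by rewrite E1 E2; ring.
Qed.

Lemma elliptic_gZ c s t w a b : w != 0 -> w ^+ 2 = s ^+ 2 / 4 - c ^+ 2 ->
  t * (s / 2 + w) = c -> t * c = s / 2 - w ->
  gZ t (step c s a b).1 (step c s a b).2 = gZ t a b.
Proof.
move=> w0 w2 tc tc'; have [z1 z2] := elliptic_step a b w0 w2 tc tc'.
by rewrite /gZ z1 z2 !cabsM !cabs_cexpi !mul1r.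
Qed.

Lemma sin_le_id (x : R) : 0 <= x -> `|sin x| <= x.
Proof.
rewrite le_eqVlt => /predU1P[<-|x0]; first by rewrite sin0 normr0.
have [y _] := MVT x0 (fun y _ => is_derive_sin y)
  (continuous_subspaceT (@continuous_sin R)).
rewrite sin0 !subr0 => ->; rewrite normrM (gtr0_norm x0).
by rewrite ler_piMl ?cos_max// ltW.
Qed.

(** For positive [l] put [w = sqrt l <= 1/2]; then [e^w <= 1 + 2 w] and [e^(-w) >= 1 - w] give
    [3 w / (2 w)]. *)
Lemma gsin_le (l : R) : l <= 4^-1 -> `|gsin l 1| <= 3 / 2.
Proof.
move=> l4; rewrite /gsin; case: ltP => l0.
  have w0 : 0 < Num.sqrt (- l) by rewrite sqrtr_gt0 oppr_gt0.
  rewrite mulr1 normrM normfV (gtr0_norm w0) ler_pdivrMr//.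
  by have := sin_le_id (ltW w0); lra.
case: eqP => [_|/eqP l1]; first by rewrite normr1; lra.
have w0 : 0 < Num.sqrt l by rewrite sqrtr_gt0 lt_neqAle eq_sym l1.
have w2 : Num.sqrt l <= 2^-1.
  have -> : 2^-1 = Num.sqrt (2^-1 ^+ 2) :> R by rewrite sqrtr_sqr ger0_norm.
  by rewrite ler_sqrt ?exprn_ge0// exprVn -natrX.
set w := Num.sqrt l in w0 w2 *; rewrite !mulr1.
have h1 : 1 - w <= expR (- w) by exact: expR_ge1Dx.
have h2 : expR w <= 1 + 2 * w.
  have : expR (- w) * expR w = 1 by rewrite -expRD addNr expR0.
  have : (1 - w) * expR w <= expR (- w) * expR w by rewrite ler_pM2r ?expR_gt0.
  have e0 := expR_gt0 w.
  by nra.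
have h3 : expR (- w) <= expR w by rewrite ler_expR; lra.
rewrite ger0_norm; last by rewrite divr_ge0 ?subr_ge0//; lra.
by rewrite ler_pdivrMr; [lra|lra].
Qed.

(** For [l = c^2 - s^2 / 4] the left side is the determinant of [step c s]. *)
Lemma gcos_gsin (l : R) : gcos l 1 ^+ 2 - l * gsin l 1 ^+ 2 = 1.
Proof.
rewrite /gcos /gsin; case: ltP => l0.
  have w0 : 0 < Num.sqrt (- l) by rewrite sqrtr_gt0 oppr_gt0.
  set w := Num.sqrt (- l) in w0 *.
  have E : l = - w ^+ 2 by rewrite sqr_sqrtr ?opprK// oppr_ge0 ltW.
  rewrite mulr1; have := cos2Dsin2 w; move: (cos w) (sin w) => C S CS.
  transitivity (C ^+ 2 + w ^+ 2 * (S / w) ^+ 2); first by rewrite E; ring.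
  by rewrite -CS; field; rewrite gt_eqF.
case: eqP => [->|/eqP l1]; first by rewrite sqrtr0 oppr0 !mul0r expR0; field.
have w0 : 0 < Num.sqrt l by rewrite sqrtr_gt0 lt_neqAle eq_sym l1.
set w := Num.sqrt l in w0 *.
have E : l = w ^+ 2 by rewrite sqr_sqrtr.
rewrite !mulr1.
have : expR (- w) * expR w = 1 by rewrite -expRD addNr expR0.
move: (expR (- w)) (expR w) => u v uv.
transitivity (u * v); last exact: uv.
by rewrite E; field; rewrite gt_eqF.
Qed.

(** The signs [e1] and [e2] treat [step] and its inverse at once. By the determinant a diagonal
    entry has squared modulus [1 + c^2 S^2], so entries are bounded uniformly in the detuning [s],
    which is what the resonance requires. *)
Lemma step_le c s (a b a' b' : R[i]) : 0 < c <= 2^-1 ->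
  let l := c ^+ 2 - s ^+ 2 / 4 in
  forall (e1 e2 : R), `|e1| = 1 -> `|e2| = 1 ->
  a' = Complex (gcos l 1) (e1 * (s / 2 * gsin l 1)) * a + (e2 * (c * gsin l 1))%:C%C * b ->
  b' = (e2 * (c * gsin l 1))%:C%C * a + Complex (gcos l 1) (- (e1 * (s / 2 * gsin l 1))) * b ->
  nrm a' b' <= (1 + 3 * c) * nrm a b.
Proof.
move=> /andP[c0 c2] l e1 e2 he1 he2 -> ->.
have l4 : l <= 4^-1 by rewrite /l; have := sqr_ge0 s; nra.
have S32 := gsin_le l4.
have det := gcos_gsin l.
set C := gcos l 1 in det *; set S := gsin l 1 in det S32 *.
have e12 : e1 ^+ 2 = 1 by rewrite -[LHS]real_normK ?num_real// he1 expr1n.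
have cS0 : 0 <= c * `|S| by rewrite mulr_ge0// ltW.
have bound (e : R) : e ^+ 2 = 1 -> cabs (Complex C (e * (s / 2 * S))) <= 1 + c * `|S|.
  move=> e2'; rewrite -(ler_pXn2r (ltn0Sn 1)) ?nnegrE ?cabs_ge0 ?addr_ge0//.
  have -> : cabs (Complex C (e * (s / 2 * S))) ^+ 2 = 1 + c ^+ 2 * S ^+ 2.
    by rewrite cabs_sqr /= exprMn e2'; move: det; rewrite /l; lra.
  have := sqr_ge0 (c * S); have -> : (1 + c * `|S|) ^+ 2 =
    1 + 2 * (c * `|S|) + c ^+ 2 * `|S| ^+ 2 by ring.
  rewrite real_normK ?num_real//; lra.
have B1 := bound e1 e12.
have B2 : cabs (Complex C (- (e1 * (s / 2 * S)))) <= 1 + c * `|S|.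
  by rewrite -mulNr; apply: bound; rewrite sqrrN.
have B3 : cabs (e2 * (c * S))%:C%C = c * `|S|.
  by rewrite cabs_real !normrM he2 mul1r (gtr0_norm c0).
rewrite /nrm; set x := Complex C _ in B1 *; set y := Complex C _ in B2 *.
set z := (e2 * _)%:C%C in B3 *.
have := cabsD (x * a) (z * b); have := cabsD (z * a) (y * b).
rewrite !cabsM B3.
have := ler_wpM2r (cabs_ge0 a) B1; have := ler_wpM2r (cabs_ge0 b) B2.
have cS : c * `|S| <= 3 / 2 * c by rewrite mulrC ler_wpM2r// ltW.
have := ler_wpM2r (cabs_ge0 a) cS; have := ler_wpM2r (cabs_ge0 b) cS.
by lra.
Qed.

Lemma step_nrm c s a b : 0 < c <= 2^-1 ->
  mclose (3 * c) (nrm a b) (nrm (step c s a b).1 (step c s a b).2).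
Proof.
move=> hc; apply: mclose_lin; rewrite ?nrm_ge0//; last first.
  apply: (@step_le c s a b _ _ hc 1 1); rewrite ?normr1//.
    by rewrite !mul1r.
  by rewrite !mul1r.
apply: (@step_le c s _ _ a b hc (-1) (-1)); rewrite ?normrN1//.
  have det := gcos_gsin (c ^+ 2 - s ^+ 2 / 4).
  rewrite /step; move: (gcos _ _) (gsin _ _) det => C S det.
  case: a b => [a1 a2] [b1 b2]; apply: complex_eq; rewrite !ReIm /=.
    by transitivity ((C ^+ 2 - (c ^+ 2 - s ^+ 2 / 4) * S ^+ 2) * a1);
      [rewrite det mul1r|field].
  by transitivity ((C ^+ 2 - (c ^+ 2 - s ^+ 2 / 4) * S ^+ 2) * a2);
    [rewrite det mul1r|field].
have det := gcos_gsin (c ^+ 2 - s ^+ 2 / 4).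
rewrite /step; move: (gcos _ _) (gsin _ _) det => C S det.
case: a b => [a1 a2] [b1 b2]; apply: complex_eq; rewrite !ReIm /=.
  by transitivity ((C ^+ 2 - (c ^+ 2 - s ^+ 2 / 4) * S ^+ 2) * b1);
    [rewrite det mul1r|field].
by transitivity ((C ^+ 2 - (c ^+ 2 - s ^+ 2 / 4) * S ^+ 2) * b2);
  [rewrite det mul1r|field].
Qed.

End Step.

(** * Sweeping the frequency *)


Section Sweep.
Variable R : realType.
Variables c sg : R.
Hypothesis c0 : 0 < c.
Hypothesis c2 : c <= 2^-1.
Hypothesis csg : 4 * c <= sg.
Implicit Types s x : R.

Definition freq s : R := Num.sqrt (s ^+ 2 / 4 - c ^+ 2).
(** The small root of [c t^2 - s t + c = 0], equal to [(s / 2 - freq s) / c]. The standing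
    hypothesis [4 * c <= sg] keeps [freq] real and [Tau] at most 1/2 for [s >= sg]. *)
Definition Tau s : R := c / (s / 2 + freq s).

Lemma freq_gt0 s : sg <= s -> 0 < freq s.
Proof. by move=> sgs; rewrite sqrtr_gt0; have := c0; have := csg; nra. Qed.

Lemma freq_sqr s : sg <= s -> freq s ^+ 2 = s ^+ 2 / 4 - c ^+ 2.
Proof. by move=> sgs; rewrite sqr_sqrtr//; have := c0; have := csg; nra. Qed.

Lemma freq_le s : sg <= s -> freq s <= s / 2.
Proof.
move=> sgs; rewrite -(ler_pXn2r (ltn0Sn 1)) ?nnegrE ?(ltW (freq_gt0 _))//; last first.
  by have := c0; have := csg; lra.
by rewrite freq_sqr//; have := sqr_ge0 c; lra.
Qed.

Lemma freq_mono s s' : sg <= s' -> s' <= s -> freq s' <= freq s.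
Proof.
move=> sgs ss; rewrite ler_wsqrtr//.
have := c0; have := csg; nra.
Qed.

Lemma Tau_mul s : sg <= s -> Tau s * (s / 2 + freq s) = c.
Proof.
move=> sgs; rewrite /Tau divfK//.
by have := freq_gt0 sgs; have := c0; have := csg; lra.
Qed.

Lemma Tau_mulc s : sg <= s -> Tau s * c = s / 2 - freq s.
Proof.
move=> sgs; have w0 := freq_gt0 sgs.
have s0 : 0 < s / 2 + freq s by have := c0; have := csg; lra.
rewrite /Tau mulrAC; apply: (mulIf (lt0r_neq0 s0)); rewrite divfK ?lt0r_neq0//.
transitivity (s ^+ 2 / 4 - freq s ^+ 2); last by field.
by rewrite freq_sqr//; ring.
Qed.

Lemma Tau_gt0 s : sg <= s -> 0 < Tau s.
Proof.
move=> sgs; rewrite divr_gt0//.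
by have := freq_gt0 sgs; have := c0; have := csg; lra.
Qed.

Lemma Tau_le s : sg <= s -> Tau s <= 2 * c / s.
Proof.
move=> sgs; have s0 : 0 < s by have := c0; have := csg; lra.
have w0 := freq_gt0 sgs.
rewrite /Tau ler_pdivrMr; last by lra.
rewrite (_ : 2 * c / s * (s / 2 + freq s) = c + 2 * c * freq s / s); last first.
  by field; rewrite gt_eqF.
by rewrite lerDl divr_ge0 ?mulr_ge0//; have := c0; lra.
Qed.

Lemma Tau_ge s : sg <= s -> c / s <= Tau s.
Proof.
move=> sgs; have s0 : 0 < s by have := c0; have := csg; lra.
have w0 := freq_gt0 sgs; have w1 := freq_le sgs.
by rewrite /Tau ler_pM2l// lef_pV2 ?posrE; lra.
Qed.

Lemma Tau_half s : sg <= s -> Tau s <= 2^-1.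
Proof.
move=> sgs; rewrite (le_trans (Tau_le sgs))//.
have s0 : 0 < s by have := c0; have := csg; lra.
by rewrite ler_pdivrMr//; have := csg; lra.
Qed.

Lemma Tau_anti s s' : sg <= s' -> s' <= s -> Tau s <= Tau s'.
Proof.
move=> sgs ss; have w0 := freq_gt0 sgs; have w1 := freq_mono sgs ss.
have s0 : 0 < s' by have := c0; have := csg; lra.
by rewrite /Tau ler_pM2l// lef_pV2 ?posrE; lra.
Qed.

(** Parameter of the basis in which the vector is measured: the exact eigenbasis off the resonance,
    the standard basis inside, where [step] may fail to be elliptic. *)
Definition gauge s : R :=
  if sg <= s then Tau s else if s <= - sg then - Tau (- s) else 0.

Lemma sg_gt0 : 0 < sg.
Proof. by have := c0; have := csg; lra. Qed.

Lemma gauge_le s : `|gauge s| <= Tau sg.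
Proof.
rewrite /gauge; case: (leP sg s) => h1; first by rewrite gtr0_norm ?Tau_gt0// Tau_anti.
case: (leP s (- sg)) => h2; last by rewrite normr0 ltW// Tau_gt0.
by rewrite normrN gtr0_norm ?Tau_gt0 ?Tau_anti// lerNr.
Qed.

Lemma gauge_half s : `|gauge s| <= 2^-1.
Proof. by rewrite (le_trans (gauge_le _))// Tau_half. Qed.

Lemma gauge_step s a b : sg <= `|s| ->
  gZ (gauge s) (step c s a b).1 (step c s a b).2 = gZ (gauge s) a b.
Proof.
rewrite ler_normr => /orP[h|h].
  rewrite /gauge h; apply: (@elliptic_gZ _ c s (Tau s) (freq s)).
  - by rewrite lt0r_neq0// freq_gt0.
  - exact: freq_sqr.
  - exact: Tau_mul.
  - exact: Tau_mulc.
have -> : gauge s = - Tau (- s).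
  by rewrite /gauge lerNr h; case: (leP sg s) => // h'; have := sg_gt0; lra.
apply: (@elliptic_gZ _ c s _ (- freq (- s))).
- by rewrite oppr_eq0 lt0r_neq0// freq_gt0.
- by rewrite sqrrN freq_sqr// sqrrN.
- by rewrite -[RHS](Tau_mul h); ring.
- by have := Tau_mulc h; lra.
Qed.

(* Nonincreasing, with range in [[0, 4 * Tau sg]]: it majorizes the increments of
   [gauge] also across the resonance, where [gauge] jumps twice. *)
Definition variation s : R :=
  if sg <= s then Tau s else if s <= - sg then 4 * Tau sg - Tau (- s) else 2 * Tau sg.

Lemma gauge_variation s s' : s' <= s ->
  `|gauge s - gauge s'| <= variation s' - variation s.
Proof.
move=> ss; have T0 := Tau_gt0 (lexx sg); have sg0 := sg_gt0.
rewrite /gauge /variation.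
case: (leP sg s) => h1; case: (leP sg s') => h2.
- have := Tau_anti h2 ss => h; rewrite distrC ger0_norm; lra.
- have h3 := Tau_anti (lexx sg) h1; have h4 := Tau_gt0 h1.
  case: (leP s' (- sg)) => h5; last by rewrite subr0 gtr0_norm//; lra.
  have h6 : sg <= - s' by lra.
  have h7 := Tau_anti (lexx sg) h6; have h8 := Tau_gt0 h6.
  by rewrite opprK gtr0_norm; lra.
- by lra.
- case: (leP s (- sg)) => h5; case: (leP s' (- sg)) => h6.
  + have h7 : sg <= - s by lra.
    have h8 : - s <= - s' by lra.
    by have := Tau_anti h7 h8 => h; rewrite ler_norml; lra.
  + by lra.
  + have h7 : sg <= - s' by lra.
    have := Tau_anti (lexx sg) h7; have := Tau_gt0 h7 => h8 h9.
    by rewrite sub0r opprK gtr0_norm; lra.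
  + by rewrite !subrr normr0.
Qed.

Lemma variation_bound s : 0 <= variation s <= 4 * Tau sg.
Proof.
have T0 := Tau_gt0 (lexx sg); rewrite /variation.
case: (leP sg s) => h1.
  by have := Tau_anti (lexx sg) h1; have := Tau_gt0 h1; lra.
case: (leP s (- sg)) => h2; last by lra.
have h3 : sg <= - s by lra.
by have := Tau_anti (lexx sg) h3; have := Tau_gt0 h3; lra.
Qed.

(** Off the resonance [gZ] is conserved exactly; inside, only the crude bound of [step_nrm]
    remains. *)
Definition near_cost s : R := if sg <= `|s| then 0 else c.

Variables s0 al : R.
Hypothesis al0 : 0 < al.
Let sq (n : nat) : R := s0 - n%:R * al.

Lemma sqS n : sq n.+1 = sq n - al.
Proof. by rewrite /sq -natr1; ring. Qed.

Variables u v : nat -> R[i].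
Variable J : nat.
Hypothesis uv : forall n, (n < J)%N ->
  u n.+1 = (step c (sq n) (u n) (v n)).1 /\ v n.+1 = (step c (sq n) (u n) (v n)).2.

(** Each step first propagates in the current basis, at cost [3 * near_cost], then passes to the
    next basis, at cost twice the increment of [gauge]. Monotonicity of [variation] makes the second
    costs telescope. *)
Lemma sweep_gZ j : (j <= J)%N ->
  mclose (2 * (variation (sq j) - variation (sq 0)) + 3 * \sum_(n < j) near_cost (sq n))
    (gZ (gauge (sq 0)) (u 0%N) (v 0%N)) (gZ (gauge (sq j)) (u j) (v j)).
Proof.
elim: j => [_|j IH jJ].
  by rewrite subrr mulr0 big_ord0 mulr0 addr0; exact: mclose_refl.
have {}IH := IH (ltnW jJ).
have [uj vj] := uv jJ.
have h1 : mclose (3 * near_cost (sq j)) (gZ (gauge (sq j)) (u j) (v j))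
    (gZ (gauge (sq j)) (u j.+1) (v j.+1)).
  rewrite uj vj /near_cost; case: ifPn => [h|h].
    by rewrite gauge_step// mulr0; exact: mclose_refl.
  have -> : gauge (sq j) = 0.
    move: h; rewrite -ltNge ltr_norml => /andP[g1 g2].
    by rewrite /gauge leNgt g2 /= leNgt g1.
  by rewrite !gZ0; apply: step_nrm; rewrite c0.
have h2 : mclose (2 * `|gauge (sq j) - gauge (sq j.+1)|)
    (gZ (gauge (sq j)) (u j.+1) (v j.+1)) (gZ (gauge (sq j.+1)) (u j.+1) (v j.+1)).
  by apply: gZ_mclose; exact: gauge_half.
apply: mclose_le (mclose_trans (mclose_trans IH h1) h2); rewrite ?gZ_ge0//.
have ss : sq j.+1 <= sq j by rewrite sqS; have := al0; lra.
by have := gauge_variation ss; rewrite big_ord_recr /=; lra.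
Qed.

Lemma sweep_nrm j : (j <= J)%N ->
  mclose (12 * Tau sg + 3 * \sum_(n < j) near_cost (sq n))
    (nrm (u 0%N) (v 0%N)) (nrm (u j) (v j)).
Proof.
move=> jJ; have h := sweep_gZ jJ.
have half0 : `|0 : R| <= 2^-1 by rewrite normr0 invr_ge0.
have h0 := gZ_mclose (u 0%N) (v 0%N) half0 (gauge_half (sq 0)).
have hj := gZ_mclose (u j) (v j) (gauge_half (sq j)) half0.
rewrite gZ0 in h0 hj; rewrite gZ0 in hj.
(* The 12 is 8 for twice the total variation, plus 2 for entering the eigenbasis and 2 for leaving
   it. *)
apply: mclose_le (mclose_trans (mclose_trans h0 h) hj); rewrite ?nrm_ge0//.
have := gauge_le (sq 0); have := gauge_le (sq j); have := variation_bound (sq 0).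
by have := variation_bound (sq j); rewrite sub0r subr0 normrN; lra.
Qed.

Lemma near_cost_sum j : \sum_(n < j) near_cost (sq n) <= c / al * (2 * sg + al).
Proof.
(* The [n]-th term is paid for by the decrease of the detuning across [-sg, sg]. *)
pose U s := c / al * Num.max 0 (Num.min (2 * sg + al) (sg - s)).
have sg0 := sg_gt0; have ca : 0 < c / al by rewrite divr_gt0.
have Ub s : 0 <= U s <= c / al * (2 * sg + al).
  have M0 : 0 <= Num.max 0 (Num.min (2 * sg + al) (sg - s)) by rewrite le_max lexx.
  have M1 : Num.max 0 (Num.min (2 * sg + al) (sg - s)) <= 2 * sg + al.
    by rewrite ge_max ge_min lexx /= andbT; have := al0; lra.
  by rewrite /U mulr_ge0 ?(ltW ca)//= ler_pM2l.
have US n : near_cost (sq n) <= U (sq n.+1) - U (sq n).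
  rewrite /near_cost; case: ifPn => h.
    rewrite subr_ge0 /U ler_pM2l// sqS ge_max le_max lexx /=.
    rewrite le_max; apply/orP; right.
    by rewrite le_min !ge_min lexx /=; apply/orP; right; have := al0; lra.
  move: h; rewrite -ltNge ltr_norml => /andP[g1 g2].
  have E : c = c / al * al by rewrite divfK// lt0r_neq0.
  rewrite {1}E /U -mulrBr ler_pM2l// sqS.
  have := al0 => al0'.
  rewrite (min_idPr _); last by lra.
  rewrite (min_idPr _); last by lra.
  rewrite (max_idPr _); last by lra.
  rewrite (max_idPr _); last by lra.
  by lra.
have : \sum_(n < j) near_cost (sq n) <= U (sq j) - U (sq 0).
  elim: j => [|j IH]; first by rewrite big_ord0 subrr.
  by rewrite big_ord_recr /=; have := US j; lra.
by have := Ub (sq 0); have := Ub (sq j); lra.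
Qed.

Lemma near_cost_sum0 j : (forall n, (n < j)%N -> sg <= `|sq n|) ->
  \sum_(n < j) near_cost (sq n) = 0.
Proof.
by move=> h; rewrite big1// => n _; rewrite /near_cost h.
Qed.

(** Before the resonance the eigencoordinates are multiplied by exact phases and only the changes of
    basis produce errors. [Tau] grows along the sweep, so these sum to [(t j - t 0) * B]; passing to
    the standard basis at both ends adds [(t j + t 0) * B], for a total of [2 * t j * B]. *)
Lemma sweep_phase j (B : R) : (j <= J)%N -> sg <= sq j ->
  (forall n, (n <= j)%N -> nrm (u n) (v n) <= B) ->
  cabs (u j - cexpi (\sum_(n < j) freq (sq n)) * u 0%N) <= 2 * Tau sg * B /\
  cabs (v j - cexpi (- \sum_(n < j) freq (sq n)) * v 0%N) <= 2 * Tau sg * B.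
Proof.
move=> jJ sgj NB.
have sqm n : (n <= j)%N -> sg <= sq n.
  move=> nj; rewrite (le_trans sgj)// /sq lerD2l lerN2 ler_wpM2r ?ler_nat//.
  exact: ltW.
have B0 : 0 <= B by rewrite (le_trans _ (NB 0%N _))// nrm_ge0.
pose t n := Tau (sq n).
pose z n := gz (t n) (u n) (v n).
pose w n := gw (t n) (u n) (v n).
have key n : (n <= j)%N ->
    cabs (z n - cexpi (\sum_(i < n) freq (sq i)) * z 0%N) <= (t n - t 0%N) * B /\
    cabs (w n - cexpi (- \sum_(i < n) freq (sq i)) * w 0%N) <= (t n - t 0%N) * B.
  elim: n => [_|n IH nj].
    by rewrite big_ord0 oppr0 cexpi0 !mul1r !subrr mul0r cabs0.
  have [IHz IHw] := IH (ltnW nj).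
  have sn := sqm _ (ltnW nj).
  have [uj vj] := uv (leq_trans nj jJ).
  have [ez ew] := elliptic_step (u n) (v n) (lt0r_neq0 (freq_gt0 sn)) (freq_sqr sn)
    (Tau_mul sn) (Tau_mulc sn).
  rewrite -uj -vj -/(t n) in ez ew.
  have tt : t n <= t n.+1.
    by apply: Tau_anti; [exact: sqm|rewrite sqS; have := al0; lra].
  have Nb := NB _ nj.
  have ub : cabs (u n.+1) <= B by rewrite (le_trans _ Nb)// lerDl cabs_ge0.
  have vb : cabs (v n.+1) <= B by rewrite (le_trans _ Nb)// lerDr cabs_ge0.
  have e0 : `|t n - t n.+1| = t n.+1 - t n by rewrite distrC ger0_norm// subr_ge0.
  rewrite !big_ord_recr /=; set S := \sum_(i < n) _ in IHz IHw *.
  split.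
    have -> : z n.+1 - cexpi (S + freq (sq n)) * z 0%N =
        cexpi (freq (sq n)) * (z n - cexpi S * z 0%N) +
        Complex 0 (t n - t n.+1) * v n.+1.
      have -> : z n.+1 = gz (t n) (u n.+1) (v n.+1) + Complex 0 (t n - t n.+1) * v n.+1.
        by rewrite /z /gz; case: (u n.+1) (v n.+1) => [? ?] [? ?];
           apply: complex_eq; rewrite !ReIm /=; ring.
      by rewrite cexpiD ez -/(z n); ring.
    rewrite (le_trans (cabsD _ _))// !cabsM cabs_cexpi cabs_imag mul1r e0.
    have : (t n.+1 - t n) * cabs (v n.+1) <= (t n.+1 - t n) * B.
      by rewrite ler_wpM2l// subr_ge0.
    by move: IHz; lra.
  have -> : w n.+1 - cexpi (- (S + freq (sq n))) * w 0%N =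
      cexpi (- freq (sq n)) * (w n - cexpi (- S) * w 0%N) +
      - (Complex 0 (t n - t n.+1) * u n.+1).
    have -> : w n.+1 = gw (t n) (u n.+1) (v n.+1) - Complex 0 (t n - t n.+1) * u n.+1.
      by rewrite /w /gw; case: (u n.+1) (v n.+1) => [? ?] [? ?];
         apply: complex_eq; rewrite !ReIm /=; ring.
    by rewrite opprD cexpiD ew -/(w n); ring.
  rewrite (le_trans (cabsD _ _))// cabsN !cabsM cabs_cexpi cabs_imag mul1r e0.
  have : (t n.+1 - t n) * cabs (u n.+1) <= (t n.+1 - t n) * B.
    by rewrite ler_wpM2l// subr_ge0.
  by move: IHw; lra.
have [kz kw] := key j (leqnn j).
have t0 : 0 < t 0%N by apply: Tau_gt0; exact: sqm.
have tj : 0 < t j by exact: Tau_gt0.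
have tjB : t j * B <= Tau sg * B by rewrite ler_wpM2r// Tau_anti.
have N0 := NB 0%N (leq0n _); have Nj := NB j (leqnn _).
have u0b : cabs (u 0%N) <= B by rewrite (le_trans _ N0)// lerDl cabs_ge0.
have v0b : cabs (v 0%N) <= B by rewrite (le_trans _ N0)// lerDr cabs_ge0.
have ujb : cabs (u j) <= B by rewrite (le_trans _ Nj)// lerDl cabs_ge0.
have vjb : cabs (v j) <= B by rewrite (le_trans _ Nj)// lerDr cabs_ge0.
set S := \sum_(i < j) _ in kz kw *.
split.
  have -> : u j - cexpi S * u 0%N = (z j - cexpi S * z 0%N) +
     (Complex 0 (t j) * v j - cexpi S * (Complex 0 (t 0%N) * v 0%N)).
    by rewrite /z /gz; ring.
  rewrite (le_trans (cabsD _ _))//.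
  have := cabsB (Complex 0 (t j) * v j) (cexpi S * (Complex 0 (t 0%N) * v 0%N)).
  rewrite !cabsM !cabs_imag cabs_cexpi mul1r !gtr0_norm//.
  have := ler_wpM2l (ltW tj) vjb; have := ler_wpM2l (ltW t0) v0b.
  by lra.
have -> : v j - cexpi (- S) * v 0%N = (w j - cexpi (- S) * w 0%N) +
   (cexpi (- S) * (Complex 0 (t 0%N) * u 0%N) - Complex 0 (t j) * u j).
  by rewrite /w /gw; ring.
rewrite (le_trans (cabsD _ _))//.
have := cabsB (cexpi (- S) * (Complex 0 (t 0%N) * u 0%N)) (Complex 0 (t j) * u j).
rewrite !cabsM !cabs_imag cabs_cexpi mul1r !gtr0_norm//.
have := ler_wpM2l (ltW tj) ujb; have := ler_wpM2l (ltW t0) u0b.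
by lra.
Qed.

End Sweep.

(** * Quantitative bounds *)


Section Constants.
Variable R : realType.

Lemma cos_antitone (x y : R) : 0 <= x -> x <= y -> y <= 2 -> cos y <= cos x.
Proof.
move=> x0 xy y2; have pi2 := pi_ge2 R.
by rewrite leNgt ltr_cos -?leNgt// in_itv /=; lra.
Qed.

Lemma cos1_lt1 : cos 1 < 1 :> R.
Proof.
rewrite -[ltRHS]cos0 ltr_cos ?ltr01// in_itv /=; have := pi_ge2 R; lra.
Qed.

Lemma hyp_g_cabs (k : R) : cabs (hyp_g k 1) ^+ 2 =
  4^-1 * (9 / 4 * gsin (- (k / 2) ^+ 2) 1 ^+ 2 +
          4^-1 * ((k / 2) * hyp_R (k / 2) 1) ^+ 2).
Proof.
rewrite /hyp_g cabsM cabs_cexpi mul1r cabs_sqr /hyp_u /hyp_v.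
move: (hyp_R _ _) (gcos _ _) (gsin _ _) => r C S.
by rewrite !ReIm /=; field.
Qed.

(** For [|k / 2| <= 1] the term with [gsin], that is [sin kap / kap], is at least [cos 1] by the
    mean value theorem. For larger [k] the two terms of [hyp_g_cabs] cannot both be small, because
    [cos^2 + sin^2 = 1]. *)
Lemma hyp_g_lower (k : R) : cos 1 / 3 / (1 + `|k|) <= cabs (hyp_g k 1).
Proof.
have c1 := cos1_gt0 R; have c1' := cos1_lt1.
have k0 := normr_ge0 k.
rewrite -(ler_pXn2r (ltn0Sn 1)) ?nnegrE ?cabs_ge0//; last first.
  by rewrite !divr_ge0//; lra.
rewrite hyp_g_cabs; set kap := k / 2.
have kk : `|k| = 2 * `|kap| by rewrite /kap normrM (ger0_norm (_ : 0 <= 2^-1)) //; field.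
have sq2 (x : R) : (x / (1 + `|k|)) ^+ 2 = x ^+ 2 / (1 + `|k|) ^+ 2 by rewrite exprMn exprVn.
rewrite sq2 ler_pdivrMr; last by rewrite exprn_gt0//; lra.
have [kap1|kap1] := leP `|kap| 1.
  have S1 : cos 1 <= gsin (- kap ^+ 2) 1.
    rewrite /gsin oppr_lt0 opprK sqrtr_sqr exprn_even_gt0//= mulr1.
    case: eqVneq => [->|kap0] /=.
      by rewrite expr0n /= oppr0 eqxx ltW.
    have w0 : 0 < `|kap| by rewrite normr_gt0.
    have [y] := MVT w0 (fun y _ => is_derive_sin y) (continuous_subspaceT (@continuous_sin R)).
    rewrite in_itv /= sin0 !subr0 => /andP[y0 y1] ->.
    by rewrite mulfK ?gt_eqF// cos_antitone//; lra.
  set S := gsin _ _ in S1 *; set r := _ * hyp_R _ _.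
  have h1 := sqr_ge0 r; have h2 : cos 1 ^+ 2 <= S ^+ 2 by nra.
  have h3 : 1 <= (1 + `|k|) ^+ 2 by nra.
  have h4 := sqr_ge0 (cos 1 : R).
  have h5 : 4^-1 * (9 / 4 * cos 1 ^+ 2) <=
     4^-1 * (9 / 4 * S ^+ 2 + 4^-1 * r ^+ 2) by lra.
  have h6 : 4^-1 * (9 / 4 * cos 1 ^+ 2) <=
     4^-1 * (9 / 4 * S ^+ 2 + 4^-1 * r ^+ 2) * (1 + `|k|) ^+ 2.
    apply: (le_trans h5); rewrite ler_peMr//.
    by have := sqr_ge0 S; lra.
  by apply: le_trans h6; rewrite exprMn exprVn; lra.
have RE := hyp_RE kap 1.
have w0 : 0 < `|kap| by lra.
have kapn : kap != 0 by rewrite -normr_gt0.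
rewrite mul1r /gcos /gsin oppr_lt0 opprK sqrtr_sqr exprn_even_gt0//= kapn mulr1 in RE *.
set w := `|kap| in kap1 w0 kk RE *.
have w2 : kap ^+ 2 = w ^+ 2 by rewrite real_normK ?num_real.
have -> : (kap * hyp_R kap 1) ^+ 2 = (kap ^+ 2 * hyp_R kap 1) ^+ 2 / w ^+ 2.
  by rewrite -w2; field.
rewrite RE kk.
have := cos2Dsin2 w; move: (cos w) (sin w) => C S CS.
have -> : 4^-1 * (9 / 4 * (S / w) ^+ 2 + 4^-1 * ((C - S / w) ^+ 2 / w ^+ 2)) *
    (1 + 2 * w) ^+ 2 =
    4^-1 * (9 / 4 * S ^+ 2 + 4^-1 * (C - S * w^-1) ^+ 2) * ((1 + 2 * w) / w) ^+ 2.
  by field; rewrite gt_eqF.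
have t1 : w^-1 <= 1 by rewrite invf_le1 ?ltW.
have t0 : 0 < w^-1 by rewrite invr_gt0.
have h1 : 2 <= (1 + 2 * w) / w by rewrite ler_pdivlMr//; lra.
have h2 : 4 <= ((1 + 2 * w) / w) ^+ 2 by nra.
have h3 : (C - S * w^-1) ^+ 2 >= C ^+ 2 / 2 - S ^+ 2.
  have : (S * w^-1) ^+ 2 <= S ^+ 2.
    rewrite exprMn ler_piMr ?sqr_ge0// expr_le1// ltW//.
  have := sqr_ge0 (C - 2 * (S * w^-1)); lra.
have h4 : 8^-1 <= 9 / 4 * S ^+ 2 + 4^-1 * (C - S * w^-1) ^+ 2.
  by have := sqr_ge0 S; lra.
set x := 9 / 4 * _ + _ in h4 *; set y := (_ / w) ^+ 2 in h2 *.
have h5 : 8^-1 <= 4^-1 * x * y by nra.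
apply: le_trans h5; rewrite exprMn exprVn.
by nra.
Qed.

End Constants.

(** * Phase accumulated before the resonance *)

Section Rotation.
Variable R : realType.

(* [y^-1 >= ln (y + 1) - ln y] makes the accumulated phase telescope. *)
Lemma ln_succ (y : R) : 0 < y -> ln (y + 1) - ln y <= y^-1.
Proof.
move=> y0; rewrite -ln_div ?posrE; [|lra|lra].
rewrite (_ : (y + 1) / y = 1 + y^-1); last by field; rewrite gt_eqF.
by rewrite le_ln1Dx// (lt_trans (_ : _ < 0)) ?invr_gt0// ltrN10.
Qed.

Lemma phase_reaches_one (d r s0 : R) (W : nat) :
  0 < d -> d <= 4^-1 -> 2 <= r -> 1 <= d ^+ 2 * ln (r / 2) ->
  2 <= s0 -> s0 <= 2 * W%:R ->
  let c := d / r in let sg := r^-1 in let al := r^-1 ^+ 2 in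
  exists j : nat, [/\ j%:R <= 2 * W%:R * r ^+ 2, sg <= s0 - j%:R * al &
    1 <= \sum_(n < j) c * Tau c (s0 - n%:R * al) <= 3 / 2].
Proof.
move=> d0 d4 r2 dln s02 s0W c sg al.
have r0 : 0 < r by lra.
have sg0 : 0 < sg by rewrite invr_gt0.
have al0 : 0 < al by rewrite exprn_gt0.
have alr : al * r ^+ 2 = 1 by rewrite /al exprVn mulVf// expf_neq0// gt_eqF.
have sgal : sg = r * al by rewrite /sg /al expr2 mulrA mulfV ?mul1r// gt_eqF.
have c0 : 0 < c by rewrite divr_gt0.
have csg : 4 * c <= sg by rewrite /c -/sg; nra.
have c4 : c <= 2^-1.
  by rewrite /c ler_pdivrMr//; nra.
pose th (j : nat) := \sum_(n < j) c * Tau c (s0 - n%:R * al).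
(* [x * al = s0 - sg], so the integer part [J] of [x] is the last index whose detuning is still at
   least [sg]. *)
pose x := r ^+ 2 * s0 - r.
have x0 : 0 <= x by rewrite /x; nra.
have /andP[Jx xJ] := truncn_itv x0.
set J := Num.truncn x in Jx xJ *.
have sJ : sg <= s0 - J%:R * al.
  have : J%:R * al <= x * al by rewrite ler_pM2r.
  rewrite (_ : x * al = s0 - sg); last by rewrite /x mulrBl mulrAC (mulrC (r ^+ 2)) alr mul1r -sgal.
  by lra.
have sJ' : s0 - J%:R * al <= sg + al.
  have : x * al <= J.+1%:R * al by rewrite ler_pM2r// ltW.
  rewrite (_ : x * al = s0 - sg); last by rewrite /x mulrBl mulrAC (mulrC (r ^+ 2)) alr mul1r -sgal.
  by rewrite -natr1 mulrDl mul1r; lra.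
(* The detuning at [n] is at most [(r + 1 + J - n) * al], and [c^2 / al = d^2], so the term
   dominates [d^2 / (r + 1 + J - n)], to which [ln_succ] applies. *)
have term n : (n < J)%N -> d ^+ 2 * (ln (r + 2 + J%:R - n%:R) - ln (r + 2 + J%:R - n.+1%:R)) <=
    c * Tau c (s0 - n%:R * al).
  move=> nJ; have nJ' : n.+1%:R <= J%:R :> R by rewrite ler_nat.
  have y0 : 0 < r + 2 + J%:R - n.+1%:R by lra.
  have E : r + 2 + J%:R - n%:R = (r + 2 + J%:R - n.+1%:R) + 1 by rewrite -natr1; ring.
  have h1 := ln_succ y0; rewrite -E in h1.
  have sn : sg <= s0 - n%:R * al.
    rewrite (le_trans sJ)// lerD2l lerN2 ler_pM2r// ler_nat ltnW//.
  have h2 := Tau_ge c0 csg sn.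
  have h3 : d ^+ 2 * (ln (r + 2 + J%:R - n%:R) - ln (r + 2 + J%:R - n.+1%:R)) <=
    d ^+ 2 * (r + 2 + J%:R - n.+1%:R)^-1 by rewrite ler_pM2l// exprn_gt0.
  apply: (le_trans h3); apply: (@le_trans _ _ (c * (c / (s0 - n%:R * al)))); last first.
    by rewrite ler_pM2l.
  have -> : c * (c / (s0 - n%:R * al)) = d ^+ 2 * (al / (s0 - n%:R * al)).
    by rewrite /c /al exprVn !mulrA; congr (_ / _); field; rewrite gt_eqF.
  rewrite ler_pM2l ?exprn_gt0// -[al / _]invrK invf_div lef_pV2 ?posrE//; last first.
    by rewrite divr_gt0// (lt_le_trans sg0).
  rewrite ler_pdivrMr// -natr1.
  have -> : s0 - n%:R * al = (s0 - J%:R * al) + (J%:R - n%:R) * al by ring.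
  by move: sJ'; rewrite sgal; lra.
have tele j : (j <= J)%N ->
    d ^+ 2 * (ln (r + 2 + J%:R) - ln (r + 2 + J%:R - j%:R)) <= th j.
  elim: j => [_|j IH jJ]; first by rewrite /th big_ord0 subr0 subrr mulr0.
  have := IH (ltnW jJ); have := term j jJ; rewrite /th big_ord_recr /=; lra.
have thJ : 1 <= th J.
  apply: le_trans (tele J (leqnn J)); apply: (le_trans dln).
  rewrite ler_pM2l ?exprn_gt0// addrK.
  have JR : 2 * r ^+ 2 - r - 1 <= J%:R.
    by move: xJ; rewrite /x -natr1; nra.
  rewrite -ln_div ?posrE; [|by nra|by lra].
  rewrite ler_ln ?posrE; [|by lra|by rewrite divr_gt0//; nra].
  rewrite ler_pdivlMr; [|by lra].
  by nra.
(* For the least such index the preceding sum is below 1, and a single term is at most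
   [c / 2 <= 1/4]; this gives the upper bound. *)
have ex1 : exists j, 1 <= th j by exists J.
case: (ex_minnP ex1) => j thj jmin.
have jJ : (j <= J)%N by exact: jmin.
exists j; split.
- have : j%:R <= J%:R :> R by rewrite ler_nat.
  move: Jx; rewrite /x; nra.
- rewrite (le_trans sJ)// lerD2l lerN2 ler_pM2r// ler_nat//.
rewrite -/(th j) thj /=.
case: j thj jmin jJ => [|j] thj jmin jJ; first by rewrite /th big_ord0; lra.
have thj1 : th j < 1 by rewrite ltNge; apply/negP => /jmin; rewrite ltnn.
have sj : sg <= s0 - j%:R * al.
  rewrite (le_trans sJ)// lerD2l lerN2 ler_pM2r// ler_nat ltnW//.
have T1 := Tau_half c0 csg sj; have T0 := Tau_gt0 c0 csg sj.
rewrite /th big_ord_recr /= -/(th j).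
by nra.
Qed.

End Rotation.

(** * The sequence of sweeps *)


Section Stages.
Variable R : realType.

(** Chosen so that the total growth exponent [2 * gam / (1 + |k|)] of all sweeps is a quarter of the
    lower bound of [hyp_g_lower]. *)
Definition gam : R := cos 1 / 24.

(* The denominator turns the bound [100 * amp m], valid for the growth over a sweep
   at [|k| < 2 * m.+2], into one that decays like [1 / (1 + |k|)]. *)
Definition amp (m : nat) : R := gam * 2^-1 ^+ m / (100 * (2 * (m.+2)%:R + 1)).

Lemma gam_gt0 : 0 < gam.
Proof. by rewrite divr_gt0// cos1_gt0. Qed.

Lemma gam_le : gam <= 24^-1.
Proof. by rewrite /gam; have := @cos1_lt1 R; lra. Qed.

Lemma pow_half_gt0 (m : nat) : 0 < (2^-1 : R) ^+ m.
Proof. by rewrite exprn_gt0. Qed.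

Lemma pow_half_le1 (m : nat) : (2^-1 : R) ^+ m <= 1.
Proof. by rewrite exprn_ile1//; lra. Qed.

Lemma amp_mul m : amp m * (100 * (2 * (m.+2)%:R + 1)) = gam * 2^-1 ^+ m.
Proof.
by rewrite /amp divfK.
Qed.

Lemma amp_gt0 m : 0 < amp m.
Proof.
by rewrite /amp divr_gt0// mulr_gt0 ?gam_gt0 ?pow_half_gt0.
Qed.

Lemma amp_le m : amp m <= 2^-1 ^+ m / 4.
Proof.
have := amp_mul m; have := amp_gt0 m; have := ler0n R m.+2.
move: (m.+2%:R) => w.
by have := gam_le; have := gam_gt0; have := pow_half_gt0 m; nra.
Qed.

Lemma ex_resolution (x : R) : 0 < x -> exists r : nat, 2 <= r%:R :> R /\ 1 <= x * ln (r%:R / 2).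
Proof.
move=> x0; pose y := 2 * expR x^-1.
have e1 : 1 <= expR x^-1.
  by apply: le_trans (expR_ge1Dx _); rewrite lerDl invr_ge0 ltW.
have y0 : 0 <= y by rewrite /y; lra.
exists (Num.truncn y).+1; have := truncnS_gt y; set r := _.+1%:R => ry.
have r2 : expR x^-1 <= r / 2 by rewrite ler_pdivlMr// mulrC ltW.
split; first by move: ry; rewrite /y; lra.
rewrite mulrC -ler_pdivrMr// div1r -[leLHS]expRK ler_ln ?posrE ?expR_gt0//.
by apply: lt_le_trans r2; exact: expR_gt0.
Qed.

Variable r : nat -> nat.
Hypothesis r_ge2 : forall m, 2 <= (r m)%:R :> R.
Hypothesis r_ln : forall m, 1 <= amp m ^+ 2 * ln ((r m)%:R / 2).

Definition len (m : nat) : nat := (2 * m.+2 * r m ^ 2)%N.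

Lemma r_gt0 m : (0 < r m)%N.
Proof. by rewrite -(ltr0n R); apply: lt_le_trans (r_ge2 m). Qed.

Lemma len_gt0 m : (0 < len m)%N.
Proof. by rewrite /len !muln_gt0 r_gt0. Qed.

(* [state i = (m, j)]: the [i]-th chirp piece is the [j]-th one of the [m]-th sweep. *)
Fixpoint state (i : nat) : nat * nat :=
  if i is i'.+1 then
    let: (m, j) := state i' in
    if (j.+1 < len m)%N then (m, j.+1) else (m.+1, 0%N)
  else (0%N, 0%N).

Definition start (m : nat) : nat := \sum_(l < m) len l.

Lemma startS m : start m.+1 = (start m + len m)%N.
Proof. by rewrite /start big_ord_recr. Qed.

Lemma start_ge m : (m <= start m)%N.
Proof. by elim: m => // m IH; rewrite startS; have := len_gt0 m; lia. Qed.

Lemma state_lt i : ((state i).2 < len (state i).1)%N.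
Proof.
elim: i => [|i] /=; first exact: len_gt0.
by case: (state i) => m j /=; case: ifP => //= _ _; exact: len_gt0.
Qed.

Lemma state_start i : i = (start (state i).1 + (state i).2)%N.
Proof.
elim: i => [|i IH] /=; first by rewrite /start big_ord0.
have := state_lt i; case: (state i) IH => m j /= IH jl.
by case: ifP => /= h; rewrite ?startS; lia.
Qed.

Lemma start_state m j : (j < len m)%N -> state (start m + j) = (m, j).
Proof.
elim: m j => [|m IHm].
  elim=> [|j IHj] jl; first by rewrite /start big_ord0.
  by rewrite addnS /= IHj ?jl//; lia.
elim=> [|j IHj] jl.
  have l0 := len_gt0 m; have E : start m.+1 = (start m + (len m).-1).+1.
    by rewrite startS; lia.
  rewrite addn0 E /= IHm; last by lia.
  by rewrite prednK// ltnn.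
by rewrite addnS /= IHj ?jl//; lia.
Qed.

Definition step_amp (i : nat) : R := amp (state i).1 / (r (state i).1)%:R.

Definition step_freq (i : nat) : R :=
  (state i).2%:R * (r (state i).1)%:R^-1 ^+ 2 - ((state i).1.+2)%:R.

(** Pieces have unit length, so this is the integral of the frequency, and the phase is continuous
    from one chirp piece to the next. *)
Definition step_phase (i : nat) : R := \sum_(l < i) step_freq l.

Definition piece (n : nat) : R -> R[i] :=
  if n is i.+1 then chirp (step_amp i) (step_freq i) (step_phase i) n%:R else @hyp R.

Definition piece_f (k : R) (n : nat) : R -> R[i] :=
  if n is i.+1 then chirp_f (step_amp i) (k - step_freq i) n%:R else hyp_f k.

Definition piece_g (k : R) (n : nat) : R -> R[i] :=
  if n is i.+1 then
    chirp_g (step_amp i) (k - step_freq i) (k * n%:R - step_phase i) n%:R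
  else hyp_g k.

Lemma piece_der n (x : R) : n%:R <= x <= n.+1%:R -> exists d, cder (piece n) x d.
Proof.
case: n => [|i] /andP[nx _]; first exact: hyp_der.
exact: chirp_der.
Qed.

Lemma piece_f_der k n (x : R) : n%:R <= x <= n.+1%:R ->
  cder (piece_f k n) x (cconj (piece n x * cexpi (k * x)) * piece_g k n x).
Proof.
case: n => [|i] /andP[nx _]; first exact: hyp_f_der.
exact: chirp_f_der.
Qed.

Lemma piece_g_der k n (x : R) : n%:R <= x <= n.+1%:R ->
  cder (piece_g k n) x (piece n x * cexpi (k * x) * piece_f k n x).
Proof.
case: n => [|i] /andP[nx _]; first exact: hyp_g_der.
exact: chirp_g_der.
Qed.

Lemma piece_f_init k n : piece_f k n n%:R = 1.
Proof. by case: n => [|i]; [exact: hyp_f_init|exact: chirp_f_init]. Qed.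

Lemma piece_g_init k n : piece_g k n n%:R = 0.
Proof. by case: n => [|i]; [exact: hyp_g_init|exact: chirp_g_init]. Qed.

(** * Evolution of the transform along the sweeps, for fixed [k] *)

Section Dynamics.
Variable k : R.

Let A n : R[i] := (ab (piece_f k) (piece_g k) n).1.
Let B n : R[i] := (ab (piece_f k) (piece_g k) n).2.
(** The index counts chirp pieces; the [i]-th one starts at [i + 1] because the first unit interval
    carries [hyp]. [psi i] is the phase of [q e^(ikx)] at that point. *)
Let psi (i : nat) : R := k * i.+1%:R - step_phase i.
Let u i : R[i] := cexpi (psi i / 2) * A i.+1.
Let v i : R[i] := cexpi (- (psi i / 2)) * B i.+1.
Let N i : R := nrm (u i) (v i).

Lemma psiS i : psi i.+1 = psi i + (k - step_freq i).
Proof. by rewrite /psi /step_phase big_ord_recr /= -[in LHS]natr1; ring. Qed.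

(** The advance of [psi / 2] by [s / 2] cancels the factors [e^(-is/2)] and [e^(is/2)] of the chirp
    propagator, leaving a matrix that depends on amplitude and detuning only. *)
Lemma uv_step i :
  u i.+1 = (step (step_amp i) (k - step_freq i) (u i) (v i)).1 /\
  v i.+1 = (step (step_amp i) (k - step_freq i) (u i) (v i)).2.
Proof.
rewrite /u /v psiS.
have -> : A i.+2 = piece_f k i.+1 i.+2%:R * A i.+1 +
  cconj (piece_g k i.+1 i.+2%:R) * B i.+1 by [].
have -> : B i.+2 = piece_g k i.+1 i.+2%:R * A i.+1 +
  cconj (piece_f k i.+1 i.+2%:R) * B i.+1 by [].
rewrite /piece_f /piece_g /chirp_f /chirp_g -/(psi i) /step.
have -> : i.+2%:R - i.+1%:R = 1 :> R by rewrite -natr1; ring.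
set s := k - _; set c := step_amp i; set l := c ^+ 2 - _.
set C := gcos l 1; set S := gsin l 1.
have -> : s / 2 * i.+1%:R + - (s / 2) * i.+2%:R = - (s / 2).
  by rewrite -(natr1 i.+1); ring.
have -> : psi i - s / 2 * i.+1%:R + s / 2 * i.+2%:R = psi i / 2 + psi i / 2 + s / 2.
  by rewrite -(natr1 i.+1); field.
have -> : (psi i + s) / 2 = psi i / 2 + s / 2 by field.
rewrite !cconjM !cconj_cexpi opprK !opprD !cexpiD.
have e1 : cexpi (psi i / 2) * cexpi (- (psi i / 2)) = 1 by rewrite -cexpiD subrr cexpi0.
have e2 : cexpi (s / 2) * cexpi (- (s / 2)) = 1 by rewrite -cexpiD subrr cexpi0.
have r1 : cconj (c * S)%:C%C = (c * S)%:C%C by apply: complex_eq; rewrite /= ?oppr0.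
have r2 : cconj (Complex C (s / 2 * S)) = Complex C (- (s / 2 * S)) by [].
rewrite r1 r2 /=.
move: (cexpi (psi i / 2)) (cexpi (- (psi i / 2))) e1 => p p' e1.
move: (cexpi (s / 2)) (cexpi (- (s / 2))) e2 => q q' e2.
move: (Complex C _) (Complex C _) ((c * S)%:C%C) (A _) (B _) => y x z a b.
split.
  transitivity ((q * q') * (x * (p * a)) + (p * p') * (q * q') * (z * (p' * b))); first by ring.
  by rewrite e1 e2 !mul1r.
transitivity ((p * p') * (q * q') * (z * (p * a)) + (q * q') * (y * (p' * b))); first by ring.
by rewrite e1 e2 !mul1r.
Qed.

Lemma stage_step m j : (j < len m)%N ->
  let c := amp m / (r m)%:R in
  let s := (k + m.+2%:R) - j%:R * (r m)%:R^-1 ^+ 2 in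
  u (start m + j.+1)%N = (step c s (u (start m + j)%N) (v (start m + j)%N)).1 /\
  v (start m + j.+1)%N = (step c s (u (start m + j)%N) (v (start m + j)%N)).2.
Proof.
move=> jl c s; have := uv_step (start m + j); rewrite addnS.
rewrite /step_amp /step_freq start_state//=.
by rewrite (_ : k - _ = s)// /s; ring.
Qed.

Lemma N_E i : N i = cabs (A i.+1) + cabs (B i.+1).
Proof. by rewrite /N /nrm /u /v !cabsM !cabs_cexpi !mul1r. Qed.

(** If [|k| < 2 W] the resonance may be crossed: with [sg = 1 / r] the cost is at most [33 d],
    absorbed by the factor [2 W + 1] in [amp]. If [|k| >= 2 W] the detuning never drops below
    [|k| / 2]; that value serves as [sg], there is no resonant cost, and the remaining
    [96 d / (1 + |k|)] decays by itself. *)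
Lemma stage_close m j : (j <= len m)%N ->
  mclose (gam * 2^-1 ^+ m / (1 + `|k|)) (N (start m)) (N (start m + j)%N).
Proof.
move=> jl; have k0 := normr_ge0 k.
set d := amp m; set rr : R := (r m)%:R; set W : R := m.+2%:R.
have d0 : 0 < d := amp_gt0 m.
have d4 : d <= 4^-1.
  by have := amp_le m; have := pow_half_le1 m; rewrite -/d; lra.
have rr2 : 2 <= rr := r_ge2 m.
have rr0 : 0 < rr by lra.
have W2 : 2 <= W by rewrite /W ler_nat.
have c0 : 0 < d / rr by rewrite divr_gt0.
have cd : d / rr <= d by rewrite ler_pdivrMr//; nra.
have c2 : d / rr <= 2^-1 by lra.
have al0 : 0 < rr^-1 ^+ 2 by rewrite exprn_gt0// invr_gt0.
have E0 : start m = (start m + 0)%N by rewrite addn0.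
have lenR : (len m)%:R = 2 * W * rr ^+ 2 by rewrite /len !natrM expr2.
have gE : gam * 2^-1 ^+ m / (1 + `|k|) = d * (100 * (2 * W + 1)) / (1 + `|k|).
  by rewrite amp_mul.
have run sg (csg : 4 * (d / rr) <= sg) :=
  @sweep_nrm R (d / rr) sg c0 c2 csg (k + W) (rr^-1 ^+ 2) al0
    (fun n => u (start m + n)) (fun n => v (start m + n)) (len m) (@stage_step m) j jl.
rewrite gE [X in N X]E0.
have [kW|kW] := ltP `|k| (2 * W).
  have csg : 4 * (d / rr) <= rr^-1 by rewrite mulrA ler_piMl ?invr_ge0; lra.
  apply: mclose_le (run _ csg); rewrite ?nrm_ge0//.
  have h1 := Tau_le c0 csg (lexx _).
  have h2 := near_cost_sum c0 csg (k + W) al0 j.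
  have e1 : 2 * (d / rr) / rr^-1 = 2 * d by field; rewrite gt_eqF.
  have e2 : d / rr / rr^-1 ^+ 2 * (2 * rr^-1 + rr^-1 ^+ 2) = 2 * d + d / rr.
    by field; rewrite gt_eqF.
  have h3 : 100 * d <= d * (100 * (2 * W + 1)) / (1 + `|k|).
    by rewrite ler_pdivlMr; nra.
  by move: h1 h2; rewrite e1 e2; lra.
have k4 : 4 <= `|k| by lra.
have csg : 4 * (d / rr) <= `|k| / 2 by lra.
apply: mclose_le (run _ csg); rewrite ?nrm_ge0//.
rewrite near_cost_sum0; last first.
  move=> n nj; have nl : n%:R <= 2 * W * rr ^+ 2.
    by rewrite -lenR ler_nat; exact: leq_trans (ltnW nj) jl.
  have x1 : n%:R * rr^-1 ^+ 2 <= 2 * W.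
    by rewrite exprVn ler_pdivrMr// exprn_gt0.
  have x0 : 0 <= n%:R * rr^-1 ^+ 2 by rewrite mulr_ge0// ltW.
  move: kW k4; have [kp|kn] := ger0P k => kW k4.
    by rewrite ger0_norm; lra.
  by rewrite ler0_norm; lra.
have h1 := Tau_le c0 csg (lexx _).
have e1 : 2 * (d / rr) / (`|k| / 2) = 4 * (d / rr) / `|k|.
  by field; rewrite gt_eqF//; lra.
rewrite e1 in h1.
have h2 : 4 * (d / rr) / `|k| <= 8 * d / (1 + `|k|).
  rewrite ler_pdivrMr; last by lra.
  rewrite [leRHS]mulrAC ler_pdivlMr; last by lra.
  by nra.
have h3 : 100 * d / (1 + `|k|) <= d * (100 * (2 * W + 1)) / (1 + `|k|).
  by rewrite ler_pM2r ?invr_gt0; nra.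
have h4 : 0 <= d / (1 + `|k|) by rewrite divr_ge0//; lra.
by lra.
Qed.

Lemma sum_half (M : nat) : \sum_(l < M) (2^-1 : R) ^+ l = 2 - 2 * 2^-1 ^+ M.
Proof.
elim: M => [|M IH]; first by rewrite big_ord0 expr0; ring.
by rewrite big_ord_recr /= IH exprS; field.
Qed.

Lemma N_close i : mclose (2 * gam / (1 + `|k|)) (N 0%N) (N i).
Proof.
have k0 := normr_ge0 k; have g0 := gam_gt0.
have st M : mclose (\sum_(l < M) gam * 2^-1 ^+ l / (1 + `|k|)) (N 0%N) (N (start M)).
  elim: M => [|M IH]; first by rewrite /start !big_ord0; exact: mclose_refl.
  rewrite big_ord_recr /=; apply: (mclose_trans IH).
  by rewrite startS; exact: stage_close.
rewrite (state_start i).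
have jl := ltnW (state_lt i).
apply: mclose_le (mclose_trans (st (state i).1) (stage_close jl)); rewrite ?nrm_ge0//.
rewrite -[X in X + _]mulr_suml -mulr_sumr sum_half -mulrDl ler_pM2r ?invr_gt0; last by lra.
by have := pow_half_gt0 (state i).1; nra.
Qed.

Lemma AB_det n : cabs (A n) ^+ 2 - cabs (B n) ^+ 2 = 1.
Proof.
have := ab_det (@piece_f_der k) (@piece_g_der k) (piece_f_init k) (piece_g_init k) n.
rewrite -/(A n) -/(B n) !cabs_sqr => /(congr1 (@complex.Re R)).
by case: (A n) (B n) => [a1 a2] [b1 b2]; rewrite !ReIm /= => <-; ring.
Qed.

Lemma N_start : 1 + cos 1 / 3 / (1 + `|k|) <= N 0%N.
Proof.
have d := AB_det 1; rewrite N_E.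
have Bl : cos 1 / 3 / (1 + `|k|) <= cabs (B 1).
  have -> : B 1 = hyp_g k 1 by rewrite /B /= mulr1 mulr0 addr0.
  exact: hyp_g_lower.
have := cabs_ge0 (A 1); have := sqr_ge0 (cabs (B 1)).
by nra.
Qed.

(** Controlling [N = |A| + |B|] is enough: since [|A|^2 - |B|^2 = 1], [|A| - |B| = 1 / N <= 1], so
    [|B| >= (N - 1) / 2]. Initially [N >= 1 + x], and a loss of exponent [x / 4] leaves
    [N >= 1 + x / 2]. *)
Lemma B_lower i : cos 1 / 12 / (1 + `|k|) <= cabs (B i.+1).
Proof.
have k0 := normr_ge0 k; have c1 := cos1_gt0 R; have c1' := @cos1_lt1 R.
pose x := cos 1 / 3 / (1 + `|k|).
have x0 : 0 < x by rewrite !divr_gt0//; lra.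
have x1 : x <= 1 by rewrite /x ler_pdivrMr; lra.
have e : 2 * gam / (1 + `|k|) = x / 4 by rewrite /x /gam; field; lra.
have e' : cos 1 / 12 / (1 + `|k|) = x / 4 by rewrite /x; field; lra.
have [h _] := N_close i; rewrite e in h; rewrite e'.
have N0 := N_start; rewrite -/x in N0.
have h1 : (1 - x / 4) * N 0%N <= N i.
  have E : expR (- (x / 4)) * (expR (x / 4) * N i) = N i.
    by rewrite mulrA -expRD addNr expR0 mul1r.
  rewrite -E; apply: (@le_trans _ _ (expR (- (x / 4)) * N 0%N)).
    by rewrite ler_wpM2r ?nrm_ge0// expR_ge1Dx.
  by rewrite ler_pM2l ?expR_gt0.
have h2 : 1 + x / 2 <= N i by nra.
have d := AB_det i.+1; rewrite N_E in h2.
have a0 := cabs_ge0 (A i.+1); have b0 := cabs_ge0 (B i.+1).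
have h3 : cabs (A i.+1) - cabs (B i.+1) <= 1 by nra.
by lra.
Qed.

Lemma A_lower i : 1 <= cabs (A i.+1).
Proof.
by have d := AB_det i.+1; have := cabs_ge0 (A i.+1); have := sqr_ge0 (cabs (B i.+1)); nra.
Qed.

Lemma N_upper i : N i <= expR 1 * N 0%N.
Proof.
have [_ h] := N_close i; apply: (le_trans h); rewrite ler_wpM2r ?nrm_ge0// ler_expR.
have k0 := normr_ge0 k; rewrite ler_pdivrMr; last by lra.
by have := gam_le; lra.
Qed.

(** By [sweep_phase], [u] turns by [Om], the sum of [freq], while the reference phase [psi / 2]
    advances by the sum of [s / 2]. The excess [s / 2 - freq s = c * Tau s] sums to [th], so [A]
    turns by [- th] and [B] by [th]. *)
Lemma rotation m : `|k| <= m%:R -> exists (i j : nat) (th : R),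
  [/\ (m <= i)%N, (m <= j)%N, 1 <= th <= 3 / 2,
      cabs (A j.+1 - cexpi (- th) * A i.+1) <= 4 * amp m * (expR 1 * N 0%N) &
      cabs (B j.+1 - cexpi th * B i.+1) <= 4 * amp m * (expR 1 * N 0%N)].
Proof.
rewrite ler_norml => /andP[km1 km2].
set d := amp m; set rr : R := (r m)%:R.
have d0 : 0 < d := amp_gt0 m.
have d4 : d <= 4^-1.
  by have := amp_le m; have := pow_half_le1 m; rewrite -/d; lra.
have rr2 : 2 <= rr := r_ge2 m.
have rr0 : 0 < rr by lra.
have c0 : 0 < d / rr by rewrite divr_gt0.
have cd : d / rr <= d by rewrite ler_pdivrMr//; nra.
have c2 : d / rr <= 2^-1 by lra.
have al0 : 0 < rr^-1 ^+ 2 by rewrite exprn_gt0// invr_gt0.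
have csg : 4 * (d / rr) <= rr^-1 by rewrite mulrA ler_piMl ?invr_ge0; lra.
have W2 : m.+2%:R = m%:R + 2 :> R by rewrite -addn2 natrD.
have m0 : 0 <= m%:R :> R by [].
(* The bound [|k| <= m] puts the initial detuning [k + m + 2] between 2 and [2 (m + 2)]. *)
have [|||j [jl sj thj]] := @phase_reaches_one R d rr (k + m.+2%:R) m.+2 d0 d4 rr2.
- exact: r_ln.
- by lra.
- by lra.
have jlen : (j <= len m)%N by rewrite -(ler_nat R) /len !natrM -expr2.
have NB n : (n <= j)%N -> nrm (u (start m + n)) (v (start m + n)) <= expR 1 * N 0%N.
  by move=> _; exact: N_upper.
have [hu hv] := @sweep_phase R (d / rr) rr^-1 c0 csg (k + m.+2%:R) (rr^-1 ^+ 2) al0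
    (fun n => u (start m + n)) (fun n => v (start m + n)) (len m) (@stage_step m) j _ jlen sj NB.
exists (start m), (start m + j)%N, (\sum_(n < j) d / rr * Tau (d / rr) (k + m.+2%:R - n%:R * rr^-1 ^+ 2)).
set th := \sum_(n < j) _ in thj *.
set Om := \sum_(n < j) freq _ _ in hu hv.
have psiE : psi (start m + j) = psi (start m) + 2 * (th + Om).
  rewrite /th /Om => {th thj Om hu hv NB jl}.
  elim: j jlen sj => [|j IH] jl sj; first by rewrite !big_ord0 addn0; ring.
  have sn : rr^-1 <= k + m.+2%:R - j%:R * rr^-1 ^+ 2.
    by apply: (le_trans sj); rewrite lerD2l lerN2 ler_pM2r// ler_nat.
  rewrite addnS psiS (IH (ltnW jl) sn) !big_ord_recr /=.
  rewrite /step_freq start_state//= -/rr.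
  have := Tau_mulc c0 csg sn; rewrite mulrC => ->.
  by field; rewrite gt_eqF.
have psih : psi (start m + j) / 2 = psi (start m) / 2 + (th + Om) by rewrite psiE; field.
have tb := Tau_le c0 csg (lexx _).
have te : 2 * (d / rr) / rr^-1 = 2 * d by field; rewrite gt_eqF.
rewrite te in tb.
have NN0 : 0 <= expR 1 * N 0%N by rewrite mulr_ge0 ?expR_ge0 ?nrm_ge0.
have err : 2 * Tau (d / rr) rr^-1 * (expR 1 * N 0%N) <= 4 * d * (expR 1 * N 0%N).
  by rewrite ler_wpM2r//; lra.
split=> //.
- exact: start_ge.
- by rewrite (leq_trans (start_ge m))// leq_addr.
- apply: le_trans err; apply: le_trans hu.
  rewrite /u addn0 psih -[leLHS]mul1r -[X in X * _ <= _](cabs_cexpi (psi (start m) / 2 + (th + Om))) -cabsM.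
  rewrite le_eqVlt; apply/orP; left; apply/eqP; congr cabs.
  rewrite mulrBr !mulrA -!cexpiD; congr (_ - cexpi _ * _); ring.
- apply: le_trans err; apply: le_trans hv.
  rewrite /v addn0 psih -[leLHS]mul1r -[X in X * _ <= _](cabs_cexpi (- (psi (start m) / 2 + (th + Om)))) -cabsM.
  rewrite le_eqVlt; apply/orP; left; apply/eqP; congr cabs.
  rewrite mulrBr !mulrA -!cexpiD; congr (_ - cexpi _ * _); ring.
Qed.

End Dynamics.
End Stages.

(** * Square integrability and conclusion *)


Section SquareIntegrable.
Variable R : realType.
Local Notation mu := (@lebesgue_measure R).

Definition cell (n : nat) : set R :=
  if n is i.+1 then `[i%:R, i.+1%:R[ else `]-oo, 0[.

Lemma bigcup_cell : \bigcup_n cell n = [set: R].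
Proof.
apply/seteqP; split => // x _; have [x0|x0] := ltP x 0.
  by exists 0%N => //=; rewrite in_itv.
exists (Num.truncn x).+1 => //=; rewrite in_itv /=.
exact: truncn_itv.
Qed.

Lemma measurable_cell n : measurable (cell n).
Proof. by case: n => [|n]; exact: measurable_itv. Qed.

Lemma trivIset_cell : trivIset setT cell.
Proof.
apply/trivIsetP => i j _ _ ij; apply/seteqP; split => // x [].
case: i ij => [|i] ij; case: j ij => [|j] ij //=; rewrite !in_itv /=.
- by move=> x0 /andP[jx _]; have := le_trans (ler0n R j) jx; rewrite leNgt x0.
- by move=> /andP[jx _] x0; have := le_trans (ler0n R i) jx; rewrite leNgt x0.
move=> ix jx; move: ij; rewrite eqSS.
by rewrite -(truncn_def ix) -(truncn_def jx) eqxx.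
Qed.

Variables (p : nat -> R -> R[i]) (w : nat -> R) (K : R).
Hypothesis p_cont : forall n (x : R), n%:R <= x <= n.+1%:R -> ccontinuous (p n) x.
Hypothesis p_le : forall n (x : R), n%:R <= x <= n.+1%:R -> cabs (p n x) ^+ 2 <= w n.
Hypothesis w_sum : forall n, \sum_(i < n) w i <= K.

Lemma pot_measurable : cmeasurable (pot p).
Proof.
have gen (h : R[i] -> R) : h 0 = 0 ->
    (forall n (x : R), n%:R <= x <= n.+1%:R -> {for x, continuous (fun t => h (p n t))}) ->
    measurable_fun setT (fun x => h (pot p x)).
  move=> h0 hc; rewrite -bigcup_cell; apply/measurable_fun_bigcup => [|n].
    exact: measurable_cell.
  case: n => [|n] /=.
    apply: eq_measurable_fun (measurable_cst (0 : R)).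
    by move=> x /set_mem /=; rewrite in_itv /= => x0; rewrite /pot x0.
  suff m : measurable_fun (`[n%:R, n.+1%:R[%classic : set R) (fun x => h (p n x)).
    apply: eq_measurable_fun m => x /set_mem /=; by rewrite in_itv /= => nx; rewrite (potE _ nx).
  apply: subspace_continuous_measurable_fun; first exact: measurable_itv.
  apply: continuous_in_subspaceT => x /set_mem /=; rewrite in_itv /= => /andP[nx xn].
  by apply: hc; rewrite nx ltW.
split; apply: gen => // n x /p_cont[] //.
Qed.

Lemma pot_L2 : L2 (pot p).
Proof.
have mp := pot_measurable; split => //.
have msq : measurable_fun setT (fun x => (cabs (pot p x) ^+ 2)%:E).
  apply/measurable_EFinP; case: mp => m1 m2.
  under eq_fun do rewrite cabs_sqr.
  by apply: measurable_funD; apply: measurable_funX.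
rewrite -bigcup_cell ge0_integral_bigcup//; first last.
- exact: trivIset_cell.
- by move=> x _; rewrite lee_fin sqr_ge0.
- by rewrite bigcup_cell.
- exact: measurable_cell.
apply: (@le_lt_trans _ _ K%:E); last exact: ltry.
apply: lime_le.
  apply: is_cvg_nneseries => n _ _; apply: integral_ge0 => x _.
  by rewrite lee_fin sqr_ge0.
have bnd n : (\int[mu]_(x in cell n) (cabs (pot p x) ^+ 2)%:E <=
    (if n is i.+1 then w i else 0)%:E)%E.
  case: n => [|n].
    rewrite (eq_integral (fun=> 0%:E)) ?integral0// => x /set_mem /=.
    by rewrite in_itv /= => x0; rewrite /pot x0 cabs0 expr0n.
  apply: (@le_trans _ _ (\int[mu]_(x in cell n.+1) (w n)%:E)%E).
    apply: ge0_le_integral => //.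
    - exact: measurable_cell.
    - by move=> x _; rewrite lee_fin sqr_ge0.
    - by apply: measurable_funTS.
    - move=> x /=; rewrite in_itv /= => nx; rewrite lee_fin (potE _ nx).
      by case/andP: nx => nx xn; apply: p_le; rewrite nx ltW.
  rewrite integral_cst; last exact: measurable_cell.
  rewrite [X in (_ * X)%E](_ : _ = 1%E) ?mule1//.
  rewrite /= lebesgue_measure_itv /= lte_fin ltr_nat ltnSn -EFinB.
  by rewrite -natr1 addrAC subrr add0r.
near=> n.
apply: (@le_trans _ _ (\sum_(0 <= i < n) (if i is j.+1 then w j else 0)%:E)%E).
  by apply: lee_sum => i _; exact: bnd.
rewrite sumEFin lee_fin big_mkord.
case: (n) => [|m]; last by rewrite big_ord_recl /= add0r; exact: w_sum.
by have := w_sum 0; rewrite !big_ord0.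
Unshelve. all: by end_near. Qed.

End SquareIntegrable.

(** * Finiteness of the L^2 norm and absence of limits *)

Section Construction.
Variable R : realType.
Variable r : nat -> nat.
Hypothesis r_ge2 : forall m, 2 <= (r m)%:R :> R.

Definition weight (n : nat) : R := if n is i.+1 then step_amp R r i ^+ 2 else 1.

Lemma piece_le n (x : R) : n%:R <= x <= n.+1%:R -> cabs (piece r n x) ^+ 2 <= weight n.
Proof.
case: n => [|i] /andP[nx _] /=.
  rewrite cabs_real expr_le1// ger0_norm; last by rewrite invr_ge0; lra.
  by rewrite invf_le1; lra.
by rewrite /chirp cabsM cabs_cexpi mulr1 cabs_real real_normK ?num_real.
Qed.

Lemma weight_sum n : \sum_(i < n) weight i <= 4.
Proof.
pose S (m : nat) : R := \sum_(l < m) 2^-1 ^+ l.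
(* [P] majorizes the partial sums: a completed sweep [m] is charged [2^-m], the running one its
   exact mass so far. *)
pose P (i : nat) : R := S (state r i).1 +
  (state r i).2%:R * (amp R (state r i).1 / (r (state r i).1)%:R) ^+ 2.
have stage m : (len r m)%:R * (amp R m / (r m)%:R) ^+ 2 <= 2^-1 ^+ m.
  have r0 : 0 < (r m)%:R :> R by have := r_ge2 m; lra.
  have -> : (len r m)%:R * (amp R m / (r m)%:R) ^+ 2 = 2 * m.+2%:R * amp R m ^+ 2.
    by rewrite /len !natrM; field; rewrite gt_eqF.
  have := @amp_mul R m; have := @amp_gt0 R m; have := @amp_le R m; have := ler0n R m.+2.
  have := @gam_le R; have := @gam_gt0 R; have := @pow_half_gt0 R m; have := @pow_half_le1 R m.
  move: (m.+2%:R) (amp R m) (gam R) (2^-1 ^+ m) => W d g h h1 h0 g0 g1 W0 dh d0 E.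
  have : 2 * W * d <= 1 by nra.
  by nra.
have PS i : step_amp R r i ^+ 2 <= P i.+1 - P i.
  rewrite /P /step_amp /=; have := state_lt r_ge2 i.
  case: (state r i) => m j /= jl; case: ifPn => /= h.
    by rewrite -(natr1 j); lra.
  have E : len r m = j.+1 by lia.
  have := stage m; rewrite E /S big_ord_recr /= -natr1; lra.
have P4 i : P i <= 2.
  rewrite /P; have := state_lt r_ge2 i; case: (state r i) => m j /= jl.
  have h1 : j%:R * (amp R m / (r m)%:R) ^+ 2 <= 2^-1 ^+ m.
    apply: le_trans (stage m); rewrite ler_wpM2r ?sqr_ge0// ler_nat ltnW//.
  by rewrite /S sum_half; have := @pow_half_gt0 R m; lra.
have P0 : P 0%N = 0 by rewrite /P /S /= big_ord0 mul0r addr0.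
have sum i : \sum_(l < i) step_amp R r l ^+ 2 <= P i.
  elim: i => [|i IH]; first by rewrite big_ord0 P0.
  by rewrite big_ord_recr /=; have := PS i; lra.
case: n => [|n]; first by rewrite big_ord0.
rewrite big_ord_recl /=; have := sum n; have := P4 n.
by lra.
Qed.

Lemma potential_L2 : L2 (pot (@piece R r)).
Proof.
apply: (@pot_L2 R (piece r) weight 4).
- by move=> n x nx; have [d pd] := @piece_der R r n x nx; exact: cder_continuous pd.
- exact: piece_le.
- exact: weight_sum.
Qed.

End Construction.

Lemma no_limit_of_oscillation (R : realType) (f : R -> R[i]) (e : R) : 0 < e ->
  (forall m : nat, exists i j : nat,
     [/\ (m <= i)%N, (m <= j)%N & e <= cabs (f j.+1%:R - f i.+1%:R)]) ->
  ~ exists l : R[i], ccvg_infty f l.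
Proof.
move=> e0 osc [l fl]; have [|M fM] := fl (e / 2); first by rewrite divr_gt0.
have [i [j [mi mj]]] := osc (Num.truncn M).
have big n : (Num.truncn M <= n)%N -> M < n.+1%:R.
  by move=> mn; rewrite (lt_le_trans (truncnS_gt M))// ler_nat.
have := cabs_sub_trans l (f j.+1%:R) (f i.+1%:R).
have -> : cabs (l - f i.+1%:R) = cabs (f i.+1%:R - l) by rewrite -cabsN opprB.
by have := fM _ (big _ mi); have := fM _ (big _ mj); lra.
Qed.

(** A rotation by an angle between 1 and 3/2, in either direction, moves [x] by at least
    [(1 - cos 1) |x|], as the real part of [e^(i th') - 1] shows; the error [del] takes away at most
    half of that. *)
Lemma rotation_gap (R : realType) (x y : R[i]) (th th' b del : R) :
  1 <= th <= 3 / 2 -> th' = th \/ th' = - th -> 0 < b -> b <= cabs x ->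
  cabs (y - cexpi th' * x) <= del -> del <= (1 - cos 1) * b / 2 ->
  (1 - cos 1) * b / 2 <= cabs (y - x).
Proof.
move=> /andP[th1 th2] thE b0 bx yx dele.
have c1 := @cos1_lt1 R.
have cth : cos th' <= cos 1.
  by case: thE => ->; rewrite ?cosN cos_antitone//; lra.
have h1 : (1 - cos 1) * b <= cabs (cexpi th' * x - x).
  rewrite (_ : _ - x = (cexpi th' - 1) * x); last by ring.
  have c1' : 0 <= 1 - cos 1 :> R by lra.
  rewrite cabsM ler_pM ?(ltW b0)//.
  by apply: le_trans (cabs_geRe _); rewrite !ReIm /= distrC ger0_norm; lra.
have := cabs_sub_trans y (cexpi th' * x) x.
have -> : cabs (cexpi th' * x - y) = cabs (y - cexpi th' * x) by rewrite -cabsN opprB.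
by lra.
Qed.

(* a(k, q^{<T>}) = X_T(T) 0 0 and b(k, q^{<T>}) = X_T(T) 1 0, where X_T is the
   solution (nlft_sol) of the ODE for the truncated potential q^{<T>}. *)
Theorem theorem1p4 (R : realType) :
  exists q : R -> R[i],
    L2 q /\
    (forall k T : R, 0 < T -> exists X : R -> 'M[R[i]]_2, nlft_sol (trunc q T) T k X) /\
    (forall (k : R) (X : R -> R -> 'M[R[i]]_2),
       (forall T : R, 0 < T -> nlft_sol (trunc q T) T k (X T)) ->
       ~ (exists l : R[i], ccvg_infty (fun T => X T T i0 i0) l) /\
       ~ (exists l : R[i], ccvg_infty (fun T => X T T i1 i0) l)).
Proof.
(* Each resolution is chosen after the amplitude of its sweep, large enough for the phase to reach
   1. *)
have [r rP] := choice (fun m => ex_resolution (exprn_gt0 2 (@amp_gt0 R m))).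
have r_ge2 m := (rP m).1; have r_ln m := (rP m).2.
exists (pot (@piece R r)); split; first exact: potential_L2.
split.
  move=> k T T0; eexists; apply: (sol_mxP (f := piece_f r k) (g := piece_g r k)) => //.
  - by move=> n x; exact: piece_der.
  - by move=> n x; exact: piece_f_der.
  - by move=> n x; exact: piece_g_der.
  - exact: piece_f_init.
  - exact: piece_g_init.
move=> k X XP.
pose A n := (ab (piece_f r k) (piece_g r k) n).1.
pose B n := (ab (piece_f r k) (piece_g r k) n).2.
have XE n : X n.+1%:R n.+1%:R i0 i0 = A n.+1 /\ X n.+1%:R n.+1%:R i1 i0 = B n.+1.
  apply: (@sol_unique R (@piece R r) k (piece_f r k) (piece_g r k) _ _ _ _ _ n) => //.
  - by move=> ? ?; exact: piece_der.
  - by move=> ? ?; exact: piece_f_der.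
  - by move=> ? ?; exact: piece_g_der.
  - exact: piece_f_init.
  - exact: piece_g_init.
  - by apply: XP; rewrite ltr0n.
have k0 := normr_ge0 k; have c1 := cos1_gt0 R; have c1' := @cos1_lt1 R.
pose b : R := cos 1 / 12 / (1 + `|k|).
have b0 : 0 < b by rewrite !divr_gt0//; lra.
have b1 : b <= 1 by rewrite /b ler_pdivrMr; lra.
pose gap := (1 - cos 1) * b / 2.
have gap0 : 0 < gap by rewrite divr_gt0// mulr_gt0// subr_gt0.
pose C : R := expR 1 * (cabs (A 1) + cabs (B 1)).
have C0 : 0 <= C by rewrite mulr_ge0 ?expR_ge0// addr_ge0 ?cabs_ge0.
have osc (m : nat) : exists i j : nat, exists th : R,
    [/\ (m <= i)%N, (m <= j)%N & 1 <= th <= 3 / 2] /\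
    (cabs (A j.+1 - cexpi (- th) * A i.+1) <= gap /\
     cabs (B j.+1 - cexpi th * B i.+1) <= gap).
  have bound (x : R) : exists n : nat, x <= n%:R.
    by exists (Num.truncn x).+1; exact/ltW/truncnS_gt.
  have [n1 kn1] := bound `|k|; have [n2 Cn2] := bound (C / gap).
  (* [m] places the sweep far out, [n1] brings [k] into its window, and [n2] makes the error
     [4 * amp M * C <= 2^-M * C] at most [gap], because [2^-M * M <= 1]. *)
  pose M := (m + n1 + n2)%N.
  have kM : `|k| <= M%:R by rewrite (le_trans kn1)// ler_nat /M addnAC leq_addl.
  have [i [j [th [Mi Mj thP hA hB]]]] := rotation r_ge2 r_ln kM.
  have small : 4 * amp R M * C <= gap.
    have CM : C / gap <= M%:R by rewrite (le_trans Cn2)// ler_nat /M leq_addl.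
    rewrite ler_pdivrMr// in CM.
    have h1 := @amp_le R M.
    have h2 : 2^-1 ^+ M * M%:R <= 1 :> R.
      rewrite exprVn mulrC ler_pdivrMr ?exprn_gt0// mul1r -natrX ler_nat.
      by rewrite ltnW// ltn_expl.
    have h3 := @pow_half_gt0 R M.
    have h4 : 4 * amp R M * C <= 2^-1 ^+ M * C by rewrite ler_wpM2r//; lra.
    by apply: (le_trans h4); nra.
  have NE := @N_E R r k 0%N.
  rewrite NE -/(A 1) -/(B 1) -/C in hA hB.
  have mM : (m <= M)%N by rewrite /M -addnA leq_addr.
  exists i, j, th; split; first by split => //; exact: leq_trans mM _.
  by split; [exact: le_trans hA small|exact: le_trans hB small].
split; apply: (no_limit_of_oscillation gap0) => m;
  have [i [j [th [[mi mj thP] [hA hB]]]]] := osc m; exists i, j; split => //.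
  have [-> _] := XE i; have [-> _] := XE j.
  apply: (rotation_gap thP _ b0 _ hA) => //; first by right.
  exact: le_trans b1 (@A_lower R r k i).
have [_ ->] := XE i; have [_ ->] := XE j.
apply: (rotation_gap thP _ b0 _ hB) => //; first by left.
exact: (B_lower r_ge2 k i).
Qed.
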